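(* Let $A\in\mathbb{R}^{d\times d}$, $B\in\mathbb{R}^{d\times n}$, $C\in\mathbb{R}^{m\times d}$, $D\in\mathbb{R}^{m\times n}$, let $$\mathcal{B}_s=\{(\mathbf{u},\mathbf{y},\mathbf{x})\in\mathcal{L}_2^{\rm loc}(\mathbb{R},\mathbb{R}^n)\times\mathcal{L}_2^{\rm loc}(\mathbb{R},\mathbb{R}^m)\times\mathcal{L}_2^{\rm loc}(\mathbb{R},\mathbb{R}^d): \tfrac{d\mathbf{x}}{dt}=A\mathbf{x}+B\mathbf{u},\ \mathbf{y}=C\mathbf{x}+D\mathbf{u}\},$$ let $V_o=\mathrm{col}(C,CA,\dots,CA^{d-1})$ and $H(\xi)=D+C(\xi I-A)^{-1}B$. Fix $t_0\in\mathbb{R}$ and for $\mathbf{x}_0\in\mathbb{R}^d$ let $S_a^{\sigma_g}(\mathbf{x}_0)$ be the supremum of $\int_{t_0}^{t_1}(\mathbf{y}^T\mathbf{y}-\mathbf{u}^T\mathbf{u})(t)\,dt$ over all $t_1\ge t_0$ and $(\mathbf{u},\mathbf{y},\mathbf{x})\in\mathcal{B}_s$ with $\mathbf{x}(t_0)=\mathbf{x}_0$ ($=\infty$ if unbounded above). The following are equivalent: 1. $S_a^{\sigma_g}(\mathbf{x}_0)<\infty$ for all $\mathbf{x}_0\in\mathbb{R}^d$. 2. There exists $X_-\in\mathbb{R}^{d\times d}_s$ such that (i) $X_-\ge0$; (ii) if $\mathbf{z}\in\mathbb{R}^d$ and $V_o\mathbf{z}=0$ then $X_-\mathbf{z}=0$;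 (iii) there exist real matrices $L,W$ with (iiia) $-A^TX_--X_-A-C^TC=L^TL$, $-D^TC-B^TX_-=W^TL$, $I-D^TD=W^TW$, and (iiib) $Z(\xi):=W+L(\xi I-A)^{-1}B$ is a spectral factor of $I-H^\star H$. Moreover, if these conditions hold (with $X_-$ any matrix as in condition 2), then $S_a^{\sigma_g}(\mathbf{x}_0)=\mathbf{x}_0^TX_-\mathbf{x}_0$ for all $\mathbf{x}_0$.
   Context: $\mathbb{R}^{d\times d}_s$ denotes real symmetric matrices; $M\ge0$ means positive semidefinite. For a real rational matrix $G$, $G^\star(\xi):=G(-\xi)^T$. If $Z\in\mathbb{R}^{r\times n}(\xi)$ and $F=Z^\star Z$, $Z$ is called a spectral factor of $F$ if $Z$ is analytic in the open right half-plane and $Z(\lambda)$ has full row rank for every $\lambda$ in the open right half-plane. $\mathcal{L}_2^{\rm loc}$ denotes locally square-integrable functions; the differential equation is interpreted in the weak sense. No controllability or observability assumption is made. *)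

(* Defs.v *)
From HB Require Import structures.
From mathcomp Require Import all_boot all_order all_algebra.
From mathcomp Require Import all_classical all_reals all_analysis.
From mathcomp Require Import complex.
Set Implicit Arguments. Unset Strict Implicit. Unset Printing Implicit Defensive.
Import Order.TTheory GRing.Theory Num.Theory.
Local Open Scope classical_set_scope.
Local Open Scope ring_scope.

Section Defs.
Variable R : realType.

Definition L2loc_scalar (f : R -> R) : Prop :=
  measurable_fun setT f /\
  forall a b : R, (\int[lebesgue_measure]_(t in `[a, b]) ((f t) ^+ 2)%:E < +oo)%E.

Definition L2loc (k : nat) (f : R -> 'cV[R]_k) : Prop :=
  forall i : 'I_k, L2loc_scalar (fun t => f t i 0).

(** (u,y,x) in B_s : x is the (continuous) representative of a weak solution of
    dx/dt = A x + B u, i.e. x t - x s = int_s^t (A x + B u) for s <= t,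
    and y = C x + D u almost everywhere. *)
Definition in_Bs (d n m : nat) (A : 'M[R]_d) (B : 'M[R]_(d, n))
    (C : 'M[R]_(m, d)) (D : 'M[R]_(m, n))
    (u : R -> 'cV[R]_n) (y : R -> 'cV[R]_m) (x : R -> 'cV[R]_d) : Prop :=
  [/\ L2loc u, L2loc y, L2loc x,
      (forall s t : R, s <= t -> forall i : 'I_d,
         (@lebesgue_measure R).-integrable `[s, t]
            (fun r => ((A *m x r + B *m u r) i 0)%:E) /\
         x t i 0 - x s i 0 =
         Rintegral (@lebesgue_measure R) `[s, t]
            (fun r => (A *m x r + B *m u r) i 0)) &
      {ae lebesgue_measure, forall t, y t = C *m x t + D *m u t}].

Definition avail_storage (d n m : nat) (A : 'M[R]_d) (B : 'M[R]_(d, n))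
    (C : 'M[R]_(m, d)) (D : 'M[R]_(m, n)) (t0 : R) (x0 : 'cV[R]_d) : \bar R :=
  ereal_sup [set v : \bar R | exists t1 (u : R -> 'cV[R]_n) (y : R -> 'cV[R]_m)
                   (x : R -> 'cV[R]_d),
     [/\ t0 <= t1, in_Bs A B C D u y x, x t0 = x0 &
         v = (\int[@lebesgue_measure R]_(t in `[t0, t1])
                (((y t)^T *m y t) 0 0 - ((u t)^T *m u t) 0 0)%:E)%E]].

Definition cmx (p q : nat) (M : 'M[R]_(p, q)) : 'M[R[i]]_(p, q) :=
  map_mx (fun r : R => r%:C%C) M.

Definition regular_pt (d : nat) (A : 'M[R]_d) (xi : R[i]) : bool :=
  \det (xi%:M - cmx A) != 0.

(** the rational matrix  W + L (xi I - A)^{-1} B  (valid at regular points) *)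
Definition ss_tf (d n r : nat) (A : 'M[R]_d) (B : 'M[R]_(d, n))
    (L : 'M[R]_(r, d)) (W : 'M[R]_(r, n)) (xi : R[i]) : 'M[R[i]]_(r, n) :=
  cmx W + cmx L *m invmx (xi%:M - cmx A) *m cmx B.

Definition rstar (p q : nat) (G : R[i] -> 'M[R[i]]_(p, q)) (xi : R[i])
  : 'M[R[i]]_(q, p) := (G (- xi))^T.

(** Z (a rational r x n matrix whose poles lie among the eigenvalues of A)
    is a spectral factor of F (an n x n rational matrix, likewise):
    F = Z^star Z as rational matrices; Z is analytic in the open right half
    plane (each entry coincides with a quotient of polynomials whose
    denominator has no zero with positive real part); and the value of
    (the analytic extension of) Z at every point of the open right half plane
    has full row rank r. *)
Definition spectral_factor (d r n : nat) (A : 'M[R]_d)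
    (Z : R[i] -> 'M[R[i]]_(r, n)) (F : R[i] -> 'M[R[i]]_n) : Prop :=
  (forall xi, regular_pt A xi -> regular_pt A (- xi) ->
      F xi = rstar Z xi *m Z xi) /\
  exists (P Q : 'I_r -> 'I_n -> {poly R[i]}),
    [/\ (forall i j (lam : R[i]), 0 < Re lam -> ~~ root (Q i j) lam),
        (forall i j (xi : R[i]), regular_pt A xi -> ~~ root (Q i j) xi ->
            Z xi i j = (P i j).[xi] / (Q i j).[xi]) &
        (forall lam : R[i], 0 < Re lam ->
            \rank (\matrix_(i < r, j < n) ((P i j).[lam] / (Q i j).[lam])) = r)].

Definition cond2 (d n m : nat) (A : 'M[R]_d) (B : 'M[R]_(d, n))
    (C : 'M[R]_(m, d)) (D : 'M[R]_(m, n)) (X : 'M[R]_d) : Prop :=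
  [/\ X^T = X,
      (forall z : 'cV[R]_d, 0 <= (z^T *m X *m z) 0 0),
      (forall z : 'cV[R]_d, (forall k : 'I_d, C *m (A ^+ k) *m z = 0) ->
          X *m z = 0) &
      exists (r : nat) (L : 'M[R]_(r, d)) (W : 'M[R]_(r, n)),
        [/\ - A^T *m X - X *m A - C^T *m C = L^T *m L,
            - D^T *m C - B^T *m X = W^T *m L,
            1%:M - D^T *m D = W^T *m W &
            spectral_factor A (ss_tf A B L W)
              (fun xi => 1%:M - rstar (ss_tf A B C D) xi *m ss_tf A B C D xi)]].
End Defs.

(* Main.v *)
Require Import Defs.
From HB Require Import structures.
From mathcomp Require Import all_boot all_order all_algebra.
From mathcomp Require Import all_classical all_reals all_analysis.
From mathcomp Require Import measurable_realfun complex ring lra.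
Import Order.TTheory GRing.Theory Num.Theory numFieldNormedType.Exports.
Local Open Scope ring_scope.

(* Write [sigma (x, u) = |C x + D u|^2 - |u|^2] and call a symmetric [X] dissipative if
   [2 x^T X (A x + B u) + sigma (x, u) <= 0] for all [x, u]. Integrating along trajectories,
   every dissipative [X >= 0] bounds the available storage [S] from above.

   If [S] is finite, it is a nonnegative function satisfying the parallelogram law (inputs may
   be extended by zero, which only increases the integral), hence a quadratic form [x^T X x];
   concatenating trajectories shows that [X] is dissipative, and so [X] is the least
   nonnegative dissipative matrix. Factor the dissipation rate as [|L x + W u|^2] with
   [(L W)] of full row rank. If [Z = W + L (xi - A)^-1 B] dropped rank at some [lam] in the
   open right half-plane, reflecting this zero into the left half-plane would produce a smaller
   nonnegative dissipative matrix.

   Conversely let [X] satisfy condition 2, let [Y <= X] be the matrix of [S], and [Del = X - Y].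
   Comparing dissipation rates, [|L x + W u|^2 + 2 x^T Del (A x + B u) >= 0] for all [x, u].
   This forces the dynamics of [x] modulo [ker Del] to be driven by [L x + W u] alone, and the
   rank condition on [Z] puts its spectrum into the closed left half-plane. The same inequality
   evaluated at a left eigenvector then shows that the eigenvalue is imaginary and
   uncontrollable, which the Lyapunov equation for [X] and the condition on [V_o] exclude.
   So [Del = 0]. *)

Set Implicit Arguments.
Unset Strict Implicit.

(** * Positive semidefinite matrices *)

Section DotProduct.
Variable R : realType.

Definition dot k (u v : 'cV[R]_k) : R := (u^T *m v) 0 0.

Lemma dotE k (u v : 'cV[R]_k) : dot u v = \sum_i u i 0 * v i 0.
Proof. by rewrite /dot mxE; apply: eq_bigr => i _; rewrite mxE. Qed.

Lemma dotC k (u v : 'cV[R]_k) : dot u v = dot v u.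
Proof. by rewrite !dotE; apply: eq_bigr => i _; rewrite mulrC. Qed.

Lemma dotDr k (u v w : 'cV[R]_k) : dot u (v + w) = dot u v + dot u w.
Proof. by rewrite /dot mulmxDr mxE. Qed.

Lemma dotDl k (u v w : 'cV[R]_k) : dot (v + w) u = dot v u + dot w u.
Proof. by rewrite dotC dotDr !(dotC u). Qed.

Lemma dotZr k c (u v : 'cV[R]_k) : dot u (c *: v) = c * dot u v.
Proof. by rewrite /dot -scalemxAr mxE. Qed.

Lemma dotZl k c (u v : 'cV[R]_k) : dot (c *: u) v = c * dot u v.
Proof. by rewrite dotC dotZr dotC. Qed.

Lemma dotNr k (u v : 'cV[R]_k) : dot u (- v) = - dot u v.
Proof. by rewrite -scaleN1r dotZr mulN1r. Qed.

Lemma dotNl k (u v : 'cV[R]_k) : dot (- u) v = - dot u v.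
Proof. by rewrite dotC dotNr dotC. Qed.

Lemma dot0r k (u : 'cV[R]_k) : dot u 0 = 0.
Proof. by rewrite -(scale0r 0) dotZr mul0r. Qed.

Lemma dot0l k (u : 'cV[R]_k) : dot 0 u = 0.
Proof. by rewrite dotC dot0r. Qed.

Lemma dot_mull k l (M : 'M[R]_(k, l)) (u : 'cV_l) (v : 'cV_k) :
  dot (M *m u) v = dot u (M^T *m v).
Proof. by rewrite /dot trmx_mul mulmxA. Qed.

Lemma dot_mulr k l (M : 'M[R]_(k, l)) (u : 'cV_l) (v : 'cV_k) :
  dot v (M *m u) = dot (M^T *m v) u.
Proof. by rewrite dot_mull trmxK. Qed.

Definition dotB := (dotDl, dotDr, dotNl, dotNr, dotZl, dotZr).

Lemma dot_ge0 k (u : 'cV[R]_k) : 0 <= dot u u.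
Proof. by rewrite dotE sumr_ge0 // => i _; rewrite -expr2 sqr_ge0. Qed.

Lemma dot_eq0 k (u : 'cV[R]_k) : dot u u = 0 -> u = 0.
Proof.
move=> /eqP; rewrite dotE psumr_eq0 => [|i _]; last by rewrite -expr2 sqr_ge0.
move=> /allP u0; apply/colP => i; apply/eqP.
by have := u0 i (mem_index_enum _); rewrite mulf_eq0 orbb mxE.
Qed.

Lemma dot_Cauchy k (u v : 'cV[R]_k) : dot u v ^+ 2 <= dot u u * dot v v.
Proof.
have [->|/eqP v0] := eqVneq v 0; first by rewrite !dot0r mulr0 expr0n.
have vv : 0 < dot v v.
  by rewrite lt_neqAle dot_ge0 andbT eq_sym; apply/eqP => /dot_eq0.
have := dot_ge0 (dot v v *: u - dot u v *: v).
rewrite !dotB (dotC v u) => h.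
have {h} : 0 <= dot v v * (dot u u * dot v v - dot u v ^+ 2).
  by apply: le_trans h _; rewrite le_eqVlt; apply/orP; left; apply/eqP; ring.
by rewrite pmulr_rge0 // subr_ge0.
Qed.

Definition psd k (X : 'M[R]_k) := X^T = X /\ forall x, 0 <= dot x (X *m x).

(** The form [h] in [(s, t)] is nonnegative, so its discriminant has a sign. Semidefiniteness allows
    vanishing pivots: [(b, -a)] is the test point for [a != 0], [(c, -b)] the one for [a = 0], and
    [(1, -b)] the one for [a = c = 0]. *)
Lemma psd_Cauchy k (X : 'M[R]_k) x y : psd X ->
  dot x (X *m y) ^+ 2 <= dot x (X *m x) * dot y (X *m y).
Proof.
move=> [Xs X0].
have Xxy : dot y (X *m x) = dot x (X *m y) by rewrite dot_mulr Xs dotC.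
set a := dot x (X *m x); set b := dot x (X *m y); set c := dot y (X *m y).
have a0 : 0 <= a by exact: X0.
have c0 : 0 <= c by exact: X0.
have h s t : 0 <= s ^+ 2 * a + 2 * s * t * b + t ^+ 2 * c.
  have := X0 (s *: x + t *: y).
  rewrite mulmxDr -!scalemxAr !dotB Xxy -/a -/b -/c => h.
  by apply: le_trans h _; rewrite le_eqVlt; apply/orP; left; apply/eqP; ring.
have [ac|ac] := eqVneq (a + c) 0.
  have [-> ->] : a = 0 /\ c = 0 by split; lra.
  have := h 1 (- b); have -> : a = 0 by lra.
  have -> : c = 0 by lra.
  nra.
have [a1|a1] := eqVneq a 0.
  have c1 : 0 < c by rewrite lt_neqAle c0 andbT eq_sym; move: ac; rewrite a1 add0r.
  have := h c (- b); rewrite a1; nra.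
have a2 : 0 < a by rewrite lt_neqAle a0 andbT eq_sym.
have := h b (- a) => h1.
have {h1} : 0 <= a * (a * c - b ^+ 2).
  by apply: le_trans h1 _; rewrite le_eqVlt; apply/orP; left; apply/eqP; ring.
by rewrite pmulr_rge0 // subr_ge0.
Qed.

(** Cauchy-Schwarz for the form of [X], applied to [X *m x] and [x], bounds [|X x|^4] by a multiple
    of [x^T X x]. *)
Lemma psd_ker k (X : 'M[R]_k) x : psd X -> dot x (X *m x) <= 0 -> X *m x = 0.
Proof.
move=> pX x0; have [Xs X0] := pX; apply: dot_eq0.
have := psd_Cauchy (X *m x) x pX.
have -> : dot x (X *m x) = 0 by apply/eqP; rewrite eq_le x0 X0.
by rewrite mulr0 => h; apply/eqP; rewrite -sqrf_eq0 eq_le h sqr_ge0.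
Qed.

(* Cholesky elimination, dropping the vanishing pivots. *)
Lemma psd_factor k (M : 'M[R]_k) : psd M ->
  exists r (N : 'M[R]_(r, k)), row_free N /\ M = N^T *m N.
Proof.
elim: k M => [|k IH] M pM.
  exists 0%N, 0; split; last by apply/matrixP => -[].
  by rewrite /row_free mxrank0.
have [Ms M0] := pM.
move: M Ms M0 pM; rewrite -[k.+1]/(1 + k)%N => M Ms M0 pM.
set a := M 0 0; set b := ursubmx M.
have aE : ulsubmx M = a%:M.
  by apply/matrixP => i j; rewrite !ord1 !mxE /a eqxx mulr1n; congr (M _ _); apply/val_inj.
have bE : dlsubmx M = b^T by rewrite /b trmx_ursub Ms.
have ME : M = block_mx a%:M b b^T (drsubmx M) by rewrite -aE -bE submxK.
have Ds : (drsubmx M)^T = drsubmx M by rewrite trmx_drsub Ms.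
have qE (s : R) (x : 'cV_k) : dot (col_mx s%:M x) (M *m col_mx s%:M x) =
    s ^+ 2 * a + 2 * s * dot b^T x + dot x (drsubmx M *m x).
  rewrite {1}ME mul_block_col /dot tr_col_mx mul_row_col tr_scalar_mx.
  rewrite !mulmxDr !mul_scalar_mx !mul_mx_scalar -?scalemxAr -?scalemxAl !mulmxA.
  have -> : x^T *m b^T = b *m x by rewrite -trmx_mul; apply/matrixP => i j; rewrite !ord1 mxE.
  by rewrite trmxK !mxE eqxx mulr1n; ring.
have a0 : 0 <= a by have := M0 (col_mx 1%:M 0); rewrite qE mulmx0 !dot0r; lra.
have [az|az] := eqVneq a 0.
  have bz : b = 0.
    apply/eqP; rewrite -trmx_eq0; apply/eqP/dot_eq0; apply/eqP.
    rewrite eq_le dot_ge0 andbT.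
    (* With a zero pivot the form is affine in the first coordinate. If [b] were nonzero, the
       coordinate chosen below would give the form the value [-1]. *)
    set e := dot b^T b^T; set f := dot b^T (drsubmx M *m b^T).
    have [->//|e0] := eqVneq e 0.
    have := M0 (col_mx (- (f + 1) / (2 * e))%:M b^T); rewrite qE az -/e -/f.
    have -> : 2 * (- (f + 1) / (2 * e)) * e = - (f + 1) by field.
    lra.
  have [|r [N [Nf NE]]] := IH (drsubmx M).
    split=> // x; have := M0 (col_mx 0%:M x); rewrite qE; nra.
  exists r, (row_mx 0 N); split.
    by rewrite -row_leq_rank rank_row_0mx row_leq_rank.
  rewrite ME az bz trmx0 tr_row_mx mul_col_row !trmx0 !mul0mx mulmx0 NE.
  by congr block_mx; apply/matrixP => i j; rewrite !mxE mul0rn.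
have a1 : 0 < a by rewrite lt_neqAle eq_sym az.
have [|r [N [Nf NE]]] := IH (drsubmx M - a^-1 *: (b^T *m b)).
  split; first by rewrite linearB linearZ /= Ds trmx_mul trmxK.
  (* The first coordinate minimises the form for fixed [x]; what remains is the Schur complement. *)
  move=> x; have := M0 (col_mx (- (a^-1 * dot b^T x))%:M x); rewrite qE.
  rewrite mulmxBl -scalemxAl !dotB -(mulmxA b^T) [dot x (b^T *m _)]dot_mulr trmxK.
  have -> : dot (b *m x) (b *m x) = dot b^T x ^+ 2.
    by rewrite dotE big_ord1 -/(_ ^+ 2) /dot trmxK.
  have -> : (- (a^-1 * dot b^T x)) ^+ 2 * a = a^-1 * dot b^T x ^+ 2 by field.
  lra.
exists (1 + r)%N, (block_mx (Num.sqrt a)%:M ((Num.sqrt a)^-1 *: b) 0 N); split.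
  have s0 : Num.sqrt a != 0 by rewrite sqrtr_eq0 -ltNge.
  apply/row_freeP; have [N' NN'] := row_freeP Nf.
  exists (block_mx (Num.sqrt a)^-1%:M (- ((Num.sqrt a)^-1 ^+ 2 *: (b *m N'))) 0 N').
  rewrite mulmx_block !mulmx0 !mul0mx !addr0 !add0r NN' -scalar_mxM divff //.
  rewrite scalar_mx_block; congr block_mx.
  rewrite mul_scalar_mx scalerN scalerA -scalemxAl expr2 mulrA divff // mul1r.
  by rewrite addNr.
have ss : Num.sqrt a * Num.sqrt a = a by rewrite -expr2 sqr_sqrtr.
rewrite ME tr_block_mx mulmx_block !tr_scalar_mx !trmx0 !mul0mx !mulmx0 !addr0.
have s0 : Num.sqrt a != 0 by rewrite sqrtr_eq0 -ltNge.
congr block_mx; first by rewrite -scalar_mxM ss.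
- by rewrite mul_scalar_mx scalerA divff // scale1r.
- by rewrite linearZ /= mul_mx_scalar scalerA divff // scale1r.
rewrite -NE linearZ /= linearZ /= -scalemxAl scalerA -invfM ss.
by rewrite addrCA subrr addr0.
Qed.
End DotProduct.

(** * Dissipation inequalities and rational matrices *)

Lemma dot_col_mx (R : realType) k l (u u' : 'cV[R]_k) (v v' : 'cV[R]_l) :
  dot (col_mx u v) (col_mx u' v') = dot u u' + dot v v'.
Proof. by rewrite /dot tr_col_mx mul_row_col mxE. Qed.

Section Dissipation.
Variables (R : realType) (d n m : nat).
Variables (A : 'M[R]_d) (B : 'M[R]_(d, n)) (C : 'M[R]_(m, d)) (D : 'M[R]_(m, n)).

Definition supply (x : 'cV[R]_d) (u : 'cV[R]_n) : R :=
  dot (C *m x + D *m u) (C *m x + D *m u) - dot u u.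

Definition dissip (X : 'M[R]_d) := forall x u,
  2 * dot x (X *m (A *m x + B *m u)) + supply x u <= 0.

(* The Lur'e equations (iiia). *)
Definition lure (X : 'M[R]_d) r (L : 'M[R]_(r, d)) (W : 'M[R]_(r, n)) :=
  [/\ - A^T *m X - X *m A - C^T *m C = L^T *m L,
      - D^T *m C - B^T *m X = W^T *m L &
      1%:M - D^T *m D = W^T *m W].

(** The three equations are the coefficients of a quadratic form in [(x, u)]: evaluate them at
    [(x, x)], [(u, x)] and [(u, u)] and add. *)
Lemma lure_dissip X r (L : 'M[R]_(r, d)) (W : 'M[R]_(r, n)) :
    X^T = X -> lure X L W -> forall x u,
  2 * dot x (X *m (A *m x + B *m u)) + supply x u =
    - dot (L *m x + W *m u) (L *m x + W *m u).
Proof.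
move=> Xs [E1 E2 E3] x u.
have := congr1 (fun M => dot x (M *m x)) E1.
have := congr1 (fun M => dot u (M *m x)) E2.
have := congr1 (fun M => dot u (M *m u)) E3.
rewrite /= !mulmxBl !mulNmx mul1mx -!mulmxA !dotB.
rewrite -!(dot_mull D) -!(dot_mull W) -!(dot_mull B) -!(dot_mull A) -!(dot_mull C) -!(dot_mull L).
rewrite /supply !mulmxDr !dotB.
rewrite (dotC (D *m u) (C *m x)) (dotC (W *m u) (L *m x)).
have -> : dot (A *m x) (X *m x) = dot x (X *m (A *m x)).
  by rewrite dotC dot_mull Xs.
have -> : dot (B *m u) (X *m x) = dot x (X *m (B *m u)).
  by rewrite dotC dot_mull Xs.
lra.
Qed.

(** [M] is the matrix of minus the dissipation rate, hence semidefinite, and [psd_factor] splits it.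
    Full row rank of [(L W)] is kept because the rank condition on the spectral factor relies on
    it. *)
Lemma dissip_lure X : X^T = X -> dissip X ->
  exists r (L : 'M[R]_(r, d)) (W : 'M[R]_(r, n)),
    row_free (row_mx L W) /\ lure X L W.
Proof.
move=> Xs dX.
pose M := block_mx (- A^T *m X - X *m A - C^T *m C) (- (C^T *m D) - X *m B)
  (- D^T *m C - B^T *m X) (1%:M - D^T *m D).
have qE x u : dot (col_mx x u) (M *m col_mx x u) =
    - (2 * dot x (X *m (A *m x + B *m u)) + supply x u).
  rewrite mul_block_col dot_col_mx !mulmxBl !mulNmx mul1mx -!mulmxA !dotB.
  rewrite -!(dot_mull D) -!(dot_mull B) -!(dot_mull A) -!(dot_mull C).
  rewrite /supply !mulmxDr !dotB (dotC (D *m u) (C *m x)).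
  have -> : dot (A *m x) (X *m x) = dot x (X *m (A *m x)).
    by rewrite dotC dot_mull Xs.
  have -> : dot (B *m u) (X *m x) = dot x (X *m (B *m u)).
    by rewrite dotC dot_mull Xs.
  ring.
have pM : psd M.
  split=> [|z]; last by rewrite -[z]vsubmxK qE oppr_ge0.
  rewrite /M tr_block_mx; congr block_mx.
  - by rewrite !linearB /= !trmx_mul linearN /= !trmxK Xs mulmxN mulNmx; congr (_ - _); rewrite addrC.
  - by rewrite [LHS]linearB /= !trmx_mul linearN /= !trmxK Xs mulmxN.
  - by rewrite linearB /= linearN /= !trmx_mul !trmxK Xs mulNmx.
  by rewrite linearB /= trmx1 trmx_mul trmxK.
have [r [N [Nf NE]]] := psd_factor pM.
exists r, (lsubmx N), (rsubmx N); split; first by rewrite hsubmxK.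
move: NE; rewrite -{1 2}[N]hsubmxK tr_row_mx mul_col_row => /eq_block_mx[? _ ? ?].
by split.
Qed.

(** With zero input the dissipation identity on [ker X] reads [|C x|^2 = - |L x|^2], so both outputs
    vanish; the first equation of [lure] then makes [ker X] invariant under [A]. *)
Lemma psd_supply_ker X r (L : 'M[R]_(r, d)) (W : 'M[R]_(r, n)) :
    psd X -> lure X L W -> forall x : 'cV_d, X *m x = 0 ->
  [/\ C *m x = 0, L *m x = 0 & X *m (A *m x) = 0].
Proof.
move=> [Xs _] lX x Xx.
have := lure_dissip Xs lX x 0.
rewrite /supply !mulmx0 !addr0 dot0r subr0 dot_mulr Xs Xx dot0l mulr0 add0r => h.
have C0 : C *m x = 0.
  by apply: dot_eq0; have := dot_ge0 (C *m x); have := dot_ge0 (L *m x); lra.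
have L0 : L *m x = 0.
  by apply: dot_eq0; have := dot_ge0 (C *m x); have := dot_ge0 (L *m x); lra.
split=> //; have [E1 _ _] := lX.
have := congr1 (mulmx^~ x) E1.
rewrite /= !mulmxBl !mulNmx -!mulmxA Xx C0 L0 !mulmx0 oppr0 sub0r addr0.
by move/eqP; rewrite oppr_eq0 => /eqP.
Qed.
End Dissipation.

(** * Projection along the kernel of a matrix *)

Section Support.
Variables (F : fieldType) (l d : nat) (X : 'M[F]_(l, d)).

(** An idempotent with the row space of [X], hence with kernel [ker X] on columns. So
    [M *m supp = M] expresses that [M] vanishes on [ker X], and [w *m supp = w] that the row [w]
    lies in the row space of [X]. *)
Definition supp := pinvmx X *m X.

Lemma mulmx_supp : X *m supp = X.
Proof. by rewrite /supp mulmxA mulmxKpV. Qed.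

Lemma supp_subP k (M : 'M[F]_(k, d)) :
  (forall x : 'cV_d, X *m x = 0 -> M *m x = 0) -> M *m supp = M.
Proof.
move=> XM; apply/eqP; rewrite eq_sym -subr_eq0 -{1}[M]mulmx1 -mulmxBr.
apply/eqP/matrixP => i j; rewrite !mxE.
have /colP/(_ i) : M *m ((1%:M - supp) *m delta_mx j (0 : 'I_1)) = 0.
  by apply: XM; rewrite mulmxA mulmxBr mulmx1 mulmx_supp subrr mul0mx.
by rewrite mulmxA -colE !mxE.
Qed.
End Support.

(** * Real and imaginary parts of complex matrices *)

Section Complexify.
Variable R : realType.
Implicit Types (p q r : nat).

Definition re_mx p q (V : 'M[R[i]]_(p, q)) : 'M[R]_(p, q) := map_mx (@complex.Re R) V.
Definition im_mx p q (V : 'M[R[i]]_(p, q)) : 'M[R]_(p, q) := map_mx (@complex.Im R) V.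

Lemma cmx_eqP p q (V V' : 'M[R[i]]_(p, q)) : re_mx V = re_mx V' -> im_mx V = im_mx V' -> V = V'.
Proof.
move=> /matrixP r /matrixP i; apply/matrixP => j k.
by have := r j k; have := i j k; rewrite !mxE => h1 h2; apply/eqP; rewrite eq_complex h1 h2 !eqxx.
Qed.

Lemma re_mxD p q (V V' : 'M[R[i]]_(p, q)) : re_mx (V + V') = re_mx V + re_mx V'.
Proof. by apply/matrixP => i j; rewrite !mxE raddfD. Qed.
Lemma im_mxD p q (V V' : 'M[R[i]]_(p, q)) : im_mx (V + V') = im_mx V + im_mx V'.
Proof. by apply/matrixP => i j; rewrite !mxE raddfD. Qed.
Lemma re_mxN p q (V : 'M[R[i]]_(p, q)) : re_mx (- V) = - re_mx V.
Proof. by apply/matrixP => i j; rewrite !mxE raddfN. Qed.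
Lemma im_mxN p q (V : 'M[R[i]]_(p, q)) : im_mx (- V) = - im_mx V.
Proof. by apply/matrixP => i j; rewrite !mxE raddfN. Qed.
Lemma re_mx0 p q : re_mx (0 : 'M[R[i]]_(p, q)) = 0.
Proof. by apply/matrixP => i j; rewrite !mxE. Qed.
Lemma im_mx0 p q : im_mx (0 : 'M[R[i]]_(p, q)) = 0.
Proof. by apply/matrixP => i j; rewrite !mxE. Qed.

Lemma re_mxMl p q r (M : 'M[R]_(p, q)) (V : 'M[R[i]]_(q, r)) : re_mx (cmx M *m V) = M *m re_mx V.
Proof.
apply/matrixP => i j; rewrite !mxE raddf_sum; apply: eq_bigr => k _.
by rewrite !mxE; case: (V k j) => a b /=; rewrite mul0r subr0.
Qed.
Lemma im_mxMl p q r (M : 'M[R]_(p, q)) (V : 'M[R[i]]_(q, r)) : im_mx (cmx M *m V) = M *m im_mx V.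
Proof.
apply/matrixP => i j; rewrite !mxE raddf_sum; apply: eq_bigr => k _.
by rewrite !mxE; case: (V k j) => a b /=; rewrite mul0r addr0.
Qed.
Lemma re_mxMr p q r (V : 'M[R[i]]_(p, q)) (M : 'M[R]_(q, r)) : re_mx (V *m cmx M) = re_mx V *m M.
Proof.
apply/matrixP => i j; rewrite !mxE raddf_sum; apply: eq_bigr => k _.
by rewrite !mxE; case: (V i k) => a b /=; rewrite mulr0 subr0.
Qed.
Lemma im_mxMr p q r (V : 'M[R[i]]_(p, q)) (M : 'M[R]_(q, r)) : im_mx (V *m cmx M) = im_mx V *m M.
Proof.
apply/matrixP => i j; rewrite !mxE raddf_sum; apply: eq_bigr => k _.
by rewrite !mxE; case: (V i k) => a b /=; rewrite mulr0 add0r.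
Qed.
Lemma re_mxZ p q c (V : 'M[R[i]]_(p, q)) :
  re_mx (c *: V) = complex.Re c *: re_mx V - complex.Im c *: im_mx V.
Proof. by apply/matrixP => i j; rewrite !mxE; case: c (V i j) => a b [e f]. Qed.
Lemma im_mxZ p q c (V : 'M[R[i]]_(p, q)) :
  im_mx (c *: V) = complex.Re c *: im_mx V + complex.Im c *: re_mx V.
Proof. by apply/matrixP => i j; rewrite !mxE; case: c (V i j) => a b [e f]. Qed.

Lemma re_cmx p q (M : 'M[R]_(p, q)) : re_mx (cmx M) = M.
Proof. by apply/matrixP => i j; rewrite !mxE. Qed.
Lemma im_cmx p q (M : 'M[R]_(p, q)) : im_mx (cmx M) = 0.
Proof. by apply/matrixP => i j; rewrite !mxE. Qed.

Definition re_mxE := (re_mxD, re_mxN, re_mxZ, re_mxMl, re_mxMr, re_cmx, re_mx0).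
Definition im_mxE := (im_mxD, im_mxN, im_mxZ, im_mxMl, im_mxMr, im_cmx, im_mx0).

Lemma cmxM p q r (M : 'M[R]_(p, q)) (N : 'M[R]_(q, r)) : cmx (M *m N) = cmx M *m cmx N.
Proof. by rewrite /cmx map_mxM. Qed.
End Complexify.

(** * Transfer functions as quotients of polynomials *)

Section RationalMatrices.
Variable R : realType.

Lemma poly_eq0_all (p : {poly R[i]}) : (forall x, p.[x] = 0) -> p = 0.
Proof.
move=> p0; apply/eqP; apply: contraT => pn0.
pose s := [seq (k%:R : R[i]) | k <- iota 0 (size p)].
have := max_poly_roots pn0 (rs := s).
rewrite size_map size_iota ltnn; apply.
  by apply/allP => x _; rewrite /root p0.
by rewrite map_inj_uniq ?iota_uniq //; apply: mulrIn; rewrite oner_neq0.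
Qed.

Lemma horner_char_poly_mx d (M : 'M[R[i]]_d) x :
  map_mx (horner_eval x) (char_poly_mx M) = x%:M - M.
Proof.
apply/matrixP => i j; rewrite !mxE /= /horner_eval hornerD hornerN hornerC.
by congr (_ - _); case: (i == j); rewrite ?mulr1n ?mulr0n ?hornerX ?horner0.
Qed.

Lemma map_horner_polyC p q (M : 'M[R[i]]_(p, q)) x :
  map_mx (horner_eval x) (map_mx polyC M) = M.
Proof. by apply/matrixP => k l; rewrite mxE mxE /= /horner_eval hornerC. Qed.

Lemma horner_char_poly d (M : 'M[R[i]]_d) x : (char_poly M).[x] = \det (x%:M - M).
Proof. by rewrite /char_poly -[LHS]/(horner_eval x _) -det_map_mx horner_char_poly_mx. Qed.

Lemma regular_ptE d (M : 'M[R]_d) x : regular_pt M x = (x%:M - cmx M \in unitmx).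
Proof. by rewrite /regular_pt unitmxE unitfE. Qed.

(** Cramer's rule, with the characteristic polynomial as common denominator. Regularity matters
    because [invmx] returns a singular matrix unchanged. *)
Lemma tf_poly d n r (M : 'M[R]_d) (B : 'M[R]_(d, n)) (L : 'M[R]_(r, d)) (W : 'M[R]_(r, n)) :
  exists P : 'I_r -> 'I_n -> {poly R[i]}, forall x i j, regular_pt M x ->
    (P i j).[x] / (char_poly (cmx M)).[x] = ss_tf M B L W x i j.
Proof.
pose PP := map_mx polyC (cmx L) *m \adj (char_poly_mx (cmx M)) *m map_mx polyC (cmx B).
exists (fun i j => (cmx W i j)%:P * char_poly (cmx M) + PP i j) => x i j rx.
have PPx : (PP i j).[x] = (cmx L *m \adj (x%:M - cmx M) *m cmx B) i j.
  have -> : (PP i j).[x] = map_mx (horner_eval x) PP i j by rewrite [RHS]mxE.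
  rewrite /PP map_mxM map_mxM map_mx_adj.
  by rewrite horner_char_poly_mx !map_horner_polyC.
rewrite hornerD hornerM hornerC PPx horner_char_poly.
rewrite /ss_tf /invmx -regular_ptE rx -scalemxAr -scalemxAl [RHS]mxE [X in _ = _ + X]mxE.
by rewrite mulrDl mulfK // [X in _ + X]mulrC.
Qed.
End RationalMatrices.

(** [G] and [H] stand for [(x - A)^-1 B] and [(- x - A)^-1 B], given by their defining equations so
    that no inverse occurs. In [key] the terms in [x] and in [A] cancel, as the two points are
    opposite. *)
Lemma lure_identity (F : comNzRingType) d n m r (A : 'M[F]_d) (B : 'M[F]_(d, n))
    (C : 'M[F]_(m, d)) (D : 'M[F]_(m, n)) (X : 'M[F]_d) (L : 'M[F]_(r, d))
    (W : 'M[F]_(r, n)) (x : F) (G H : 'M[F]_(d, n)) :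
  X^T = X ->
  - A^T *m X - X *m A - C^T *m C = L^T *m L ->
  - D^T *m C - B^T *m X = W^T *m L ->
  1%:M - D^T *m D = W^T *m W ->
  B = x *: G - A *m G -> B = - x *: H - A *m H ->
  1%:M - (D + C *m H)^T *m (D + C *m G) = (W + L *m H)^T *m (W + L *m G).
Proof.
move=> Xs E1 E2 E3 BG BH.
have tD p q (M N : 'M[F]_(p, q)) : (M + N)^T = M^T + N^T.
  by apply/matrixP => i j; rewrite !mxE.
have tN p q (M : 'M[F]_(p, q)) : (- M)^T = - M^T by apply/matrixP => i j; rewrite !mxE.
have tZ p q c (M : 'M[F]_(p, q)) : (c *: M)^T = c *: M^T.
  by apply/matrixP => i j; rewrite !mxE.
have E2' : L^T *m W = - (C^T *m D) - X *m B.
  have := congr1 trmx E2; rewrite tD !tN !trmx_mul tN !trmxK Xs.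
  by rewrite mulmxN => ->.
have BT : B^T = - x *: H^T - H^T *m A^T by rewrite {1}BH tD tN tZ trmx_mul.
have key : H^T *m (L^T *m L) *m G =
    B^T *m X *m G + H^T *m (X *m B) - H^T *m (C^T *m C) *m G.
  rewrite -E1 BT BG !(mulmxBl, mulmxBr, mulNmx, mulmxN) -!(scalemxAl, scalemxAr) !mulmxA.
  by apply/matrixP => i j; rewrite !mxE; ring.
rewrite !tD !trmx_mul !mulmxDl !mulmxDr !mulmxA -E3 -E2.
rewrite -(mulmxA _ L^T W) E2' -(mulmxA _ L^T L) key.
rewrite !(mulmxBl, mulmxBr, mulNmx, mulmxN) !mulmxA.
by apply/matrixP => i j; rewrite !mxE; ring.
Qed.

(** * Removing the kernel of X from the dynamics *)

Section Resolvent.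
Variables (R : realType) (d n m : nat).
Variables (A : 'M[R]_d) (B : 'M[R]_(d, n)) (C : 'M[R]_(m, d)) (D : 'M[R]_(m, n)).
Variables (X : 'M[R]_d) (r : nat) (L : 'M[R]_(r, d)) (W : 'M[R]_(r, n)).
Hypothesis pX : psd X.
Hypothesis lX : lure A B C D X L W.

(* Agrees with [A] modulo [ker X] and vanishes on [ker X]: the possibly unstable
   unobservable part of [A] is thereby removed. *)
Definition obs_part := supp X *m A.

Lemma mulmx_obs_part : X *m obs_part = X *m A.
Proof. by rewrite /obs_part mulmxA mulmx_supp. Qed.

Lemma L_supp : L *m supp X = L.
Proof. by apply: supp_subP => x /(psd_supply_ker pX lX)[]. Qed.

Lemma obs_part_supp : obs_part *m supp X = obs_part.
Proof.
apply: supp_subP => x /(psd_supply_ker pX lX)[_ _ XAx].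
by rewrite /obs_part /supp -!mulmxA XAx !mulmx0.
Qed.

(** For an eigenvector [p = p1 + i p2] with eigenvalue [x], dissipativity at zero input gives
    [Re x * (p1^T X p1 + p2^T X p2) <= 0]. Hence [X] kills [p1] and [p2], and so does [obs_part],
    which contradicts [x != 0]. *)
Lemma obs_part_regular x : 0 < complex.Re x -> regular_pt obs_part x.
Proof.
move=> x0; rewrite /regular_pt; apply/negP => /eqP.
rewrite -det_tr => /eqP/det0P[v v0]; move=> /(congr1 trmx).
rewrite trmx_mul trmxK trmx0 mulmxBl mul_scalar_mx => /eqP.
rewrite subr_eq0 => /eqP e; case/eqP: v0.
pose p1 := re_mx v^T; pose p2 := im_mx v^T.
have e1 : complex.Re x *: p1 - complex.Im x *: p2 = obs_part *m p1.
  by have := congr1 (@re_mx R _ _) e; rewrite !re_mxE.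
have e2 : complex.Re x *: p2 + complex.Im x *: p1 = obs_part *m p2.
  by have := congr1 (@im_mx R _ _) e; rewrite !im_mxE.
have [Xs X0] := pX.
have neg p : dot p (X *m (obs_part *m p)) <= 0.
  have := lure_dissip Xs lX p 0.
  rewrite [X *m (obs_part *m _)]mulmxA mulmx_obs_part -(mulmxA X) /supply !mulmx0 !addr0 dot0r subr0.
  by have := dot_ge0 (C *m p); have := dot_ge0 (L *m p); lra.
have := neg p1; have := neg p2.
rewrite -e1 -e2 !(mulmxDr, mulmxN) -!scalemxAr !dotB.
have -> : dot p2 (X *m p1) = dot p1 (X *m p2) by rewrite dot_mulr Xs dotC.
move: (X0 p1) (X0 p2) => X1 X2 h2 h1.
have h : complex.Re x * (dot p1 (X *m p1) + dot p2 (X *m p2)) <= 0 by lra.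
have {}h : dot p1 (X *m p1) + dot p2 (X *m p2) <= 0 by move: h; rewrite pmulr_rle0.
have Xp1 : X *m p1 = 0 by apply: psd_ker => //; lra.
have Xp2 : X *m p2 = 0 by apply: psd_ker => //; lra.
have z p : X *m p = 0 -> obs_part *m p = 0.
  by move=> Xp; rewrite -obs_part_supp /supp -!mulmxA Xp !mulmx0.
have : x *: v^T = 0.
  by rewrite e; apply: cmx_eqP; rewrite !(re_mxE, im_mxE) z.
move/eqP; rewrite scaler_eq0 => /orP[/eqP x00|].
  by move: x0; rewrite x00 ltxx.
by rewrite trmx_eq0 => /eqP.
Qed.

(** On [ker X] the matrix [obs_part] is zero, so its resolvent acts there as division by [x], and
    [L] vanishes there. *)
Lemma resolvent_supp x : regular_pt obs_part x ->
  cmx L *m invmx (x%:M - cmx obs_part) *m cmx (supp X) =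
  cmx L *m invmx (x%:M - cmx obs_part).
Proof.
rewrite regular_ptE => rx; set S := cmx (supp X); set V := invmx _.
have e : (x%:M - cmx obs_part) *m (1%:M - S) = x *: (1%:M - S).
  by rewrite mulmxBl mul_scalar_mx [X in _ - X]mulmxBr mulmx1 -cmxM obs_part_supp subrr subr0.
have {}e : 1%:M - S = x *: (V *m (1%:M - S)) by rewrite scalemxAr -e mulKmx.
apply/eqP; rewrite eq_sym -subr_eq0 -{1}[_ *m V]mulmx1 -mulmxBr -mulmxA.
(* Regularity at 0 means that [ker X] is trivial, that is [S = 1]. *)
have [x0|x0] := eqVneq x 0; first by rewrite e x0 scale0r !mulmx0.
have : x *: (cmx L *m (V *m (1%:M - S))) == 0.
  by rewrite scalemxAr -e mulmxBr mulmx1 -cmxM L_supp subrr.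
by rewrite scaler_eq0 (negPf x0).
Qed.

(** The difference of [A] and [obs_part] has its range in [ker X], which [L] times the resolvent
    annihilates. As [obs_part] has no eigenvalue in the open right half-plane, the right-hand side
    is the analytic extension of [Z] there. *)
Lemma ss_tf_obs_part x : regular_pt A x -> regular_pt obs_part x ->
  ss_tf A B L W x = ss_tf obs_part B L W x.
Proof.
move=> rA rx; rewrite /ss_tf.
suff -> : cmx L *m invmx (x%:M - cmx A) = cmx L *m invmx (x%:M - cmx obs_part) by [].
have h := resolvent_supp rx; move: rA (rx); rewrite !regular_ptE => rA rx'.
rewrite -[RHS](mulmxK rA); congr (_ *m _).
have -> : x%:M - cmx A = (x%:M - cmx obs_part) - (1%:M - cmx (supp X)) *m cmx A.
  by rewrite mulmxBl mul1mx -cmxM -/obs_part; apply/matrixP => i j; rewrite !mxE; ring.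
by rewrite mulmxBr mulmxKV // mulmxA mulmxBr mulmx1 h subrr mul0mx subr0.
Qed.

Lemma lure_spectral x : regular_pt A x -> regular_pt A (- x) ->
  1%:M - rstar (ss_tf A B C D) x *m ss_tf A B C D x =
  rstar (ss_tf A B L W) x *m ss_tf A B L W x.
Proof.
rewrite !regular_ptE => rx ry; rewrite /rstar /ss_tf.
have [E1 E2 E3] := lX; have [Xs _] := pX.
have cT p q (M : 'M[R]_(p, q)) : cmx M^T = (cmx M)^T by rewrite /cmx map_trmx.
rewrite -!mulmxA; apply: (lure_identity (A := cmx A) (B := cmx B) (X := cmx X) (x := x)).
- by rewrite -cT Xs.
- by rewrite -!cT -!cmxM -E1 /cmx !map_mxB !map_mxM map_mxN.
- by rewrite -!cT -!cmxM -E2 /cmx map_mxB !map_mxM map_mxN.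
- by rewrite -!cT -!cmxM -E3 /cmx map_mxB map_mx1 !map_mxM.
- by rewrite -mul_scalar_mx -mulmxBl mulKVmx.
by rewrite -mul_scalar_mx -mulmxBl mulKVmx.
Qed.
End Resolvent.

(** * Spectral factors *)

(* In [spectral_factor], [Re] is the real part of an element of a
   [numClosedFieldType], which is again a complex number. *)
Lemma gt0_Re (R : realType) (x : R[i]) : (0 < 'Re x) = (0 < complex.Re x).
Proof. by rewrite -complexRe ltcR. Qed.

Section SpectralFactor.
Variables (R : realType) (d n m : nat).
Variables (A : 'M[R]_d) (B : 'M[R]_(d, n)) (C : 'M[R]_(m, d)) (D : 'M[R]_(m, n)).
Variables (X : 'M[R]_d) (r : nat) (L : 'M[R]_(r, d)) (W : 'M[R]_(r, n)).
Hypothesis pX : psd X.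
Hypothesis lX : lure A B C D X L W.

Lemma dot_drift x u (w w' : 'cV[R]_d) (v : 'cV[R]_r) c c' :
  A^T *m w = c *: w + c' *: w' - L^T *m v -> B^T *m w = - (W^T *m v) ->
  dot w (A *m x + B *m u) = c * dot w x + c' * dot w' x - dot v (L *m x + W *m u).
Proof. by move=> Aw Bw; rewrite dotDr !dot_mulr Aw Bw !dotB !dot_mulr; ring. Qed.

(* Along trajectories [z = w1^T x + i w2^T x] satisfies [z' = lam z - v^T (L x + W u)] with
   [lam = a + i b], so that subtracting [eps |z|^2] from the storage function
   reflects the zero [lam] of [W + L (xi - A)^-1 B] into the left half-plane. *)
Lemma dissip_reflect a b (w1 w2 p1 p2 : 'cV[R]_d) (v1 v2 : 'cV[R]_r) :
  0 < a -> w1 = X *m p1 -> w2 = X *m p2 ->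
  A^T *m w1 = a *: w1 - b *: w2 - L^T *m v1 ->
  A^T *m w2 = a *: w2 + b *: w1 - L^T *m v2 ->
  B^T *m w1 = - (W^T *m v1) -> B^T *m w2 = - (W^T *m v2) ->
  exists2 eps, 0 < eps &
    let Y := X - eps *: (w1 *m w1^T + w2 *m w2^T) in psd Y /\ dissip A B C D Y.
Proof.
move=> a0 w1E w2E A1 A2 B1 B2; have [Xs X0] := pX.
pose k := dot p1 (X *m p1) + dot p2 (X *m p2).
pose s := dot v1 v1 + dot v2 v2.
have k0 : 0 <= k by rewrite addr_ge0.
have s0 : 0 <= s by rewrite addr_ge0 // dot_ge0.
have sa0 : 0 <= s / (2 * a) by rewrite divr_ge0 // mulr_ge0 // ltW.
(* Small enough for both needs: [eps * k <= 1] keeps [Y] nonnegative, by Cauchy-Schwarz, and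
   [eps * s <= 2 * a] keeps it dissipative. *)
pose eps := (k + s / (2 * a) + 1)^-1.
have e1 : 0 < k + s / (2 * a) + 1 by lra.
have eps0 : 0 < eps by rewrite invr_gt0.
have ek : eps * k <= 1 by rewrite /eps mulrC ler_pdivrMr //; lra.
have es : eps * s <= 2 * a.
  have h : s = (s / (2 * a)) * (2 * a) by field; rewrite lt0r_neq0.
  rewrite h mulrA; apply: ler_piMl; first lra.
  by rewrite /eps mulrC ler_pdivrMr //; lra.
exists eps => //.
set Y := X - _.
have YE x y : dot x (Y *m y) =
    dot x (X *m y) - eps * (dot w1 x * dot w1 y + dot w2 x * dot w2 y).
  have h (w : 'cV[R]_d) : dot x ((w *m w^T) *m y) = dot w x * dot w y.
    have -> : w *m w^T *m y = dot w y *: w.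
      by rewrite -mulmxA [w^T *m y]mx11_scalar mul_mx_scalar.
    by rewrite dotZr mulrC (dotC x).
  by rewrite mulmxBl -scalemxAl mulmxDl !dotB !h.
split.
  split=> [|x].
    rewrite /Y; apply/matrixP => i j; rewrite !mxE -{1}Xs mxE.
    by rewrite !big_ord1 !mxE; ring.
  rewrite YE.
  have := psd_Cauchy p1 x pX; have := psd_Cauchy p2 x pX.
  have wE w p : w = X *m p -> dot p (X *m x) = dot w x by move->; rewrite dot_mulr Xs.
  rewrite (wE _ _ w1E) (wE _ _ w2E) => h2 h1.
  have h : dot w1 x ^+ 2 + dot w2 x ^+ 2 <= k * dot x (X *m x).
    by rewrite /k mulrDl lerD.
  rewrite -!expr2 subr_ge0; apply: (le_trans (ler_wpM2l (ltW eps0) h)).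
  by rewrite mulrA ler_piMl.
move=> x u; rewrite YE mulrBr addrAC (lure_dissip Xs lX).
set e := L *m x + W *m u.
rewrite (@dot_drift _ _ w1 w2 v1 a (- b)) //; last by rewrite A1 scaleNr.
rewrite (@dot_drift _ _ w2 w1 v2 a b) //.
have c1 := dot_Cauchy v1 e; have c2 := dot_Cauchy v2 e; have e0 := dot_ge0 e.
set z1 := dot w1 x; set z2 := dot w2 x.
have {c1 c2} c : eps * (dot v1 e ^+ 2 + dot v2 e ^+ 2) <= 2 * a * dot e e.
  apply: (le_trans (y := eps * (s * dot e e))).
    by rewrite ler_pM2l // /s mulrDl lerD.
  by rewrite mulrA ler_wpM2r.
(* Completing the square in [z1] and [z2]: the cross terms in [b] cancel, and [c] absorbs what
   remains. *)
have sq1 : 0 <= (2 * a * z1 - dot v1 e) ^+ 2 := sqr_ge0 _.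
have sq2 : 0 <= (2 * a * z2 - dot v2 e) ^+ 2 := sqr_ge0 _.
rewrite -(pmulr_rle0 _ a0).
move: (dot e e) (dot v1 e) (dot v2 e) sq1 sq2 c e0 => E V1 V2 sq1 sq2 c e0.
have := mulr_ge0 (ltW eps0) (addr_ge0 sq1 sq2).
have -> : eps * ((2 * a * z1 - V1) ^+ 2 + (2 * a * z2 - V2) ^+ 2) =
  4 * a * (eps * (z1 * (a * z1 - V1) + z2 * (a * z2 - V2))) + eps * (V1 ^+ 2 + V2 ^+ 2) by ring.
move=> h.
have -> : a * (- E - 2 * (eps * (z1 * (a * z1 + - b * z2 - V1) + z2 * (a * z2 + b * z1 - V2)))) =
  - a * E - 2 * a * (eps * (z1 * (a * z1 - V1) + z2 * (a * z2 - V2))) by ring.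
lra.
Qed.

Hypothesis fX : row_free (row_mx L W).
Hypothesis minX : forall Y, psd Y -> dissip A B C D Y ->
  forall x, dot x (X *m x) <= dot x (Y *m x).

(** A left null vector [v] yields the row [w = v L (lam - obs_part)^-1] with [w A = lam w - v L] and
    [w B = - v W]. Unless [w = 0], [dissip_reflect] produces a nonnegative dissipative matrix below
    [X], against minimality. With [w = 0], [v] annihilates [(L W)], which has full row rank. *)
Lemma minimal_full_rank lam (v : 'rV[R[i]]_r) : 0 < complex.Re lam ->
  v *m ss_tf (obs_part A X) B L W lam = 0 -> v = 0.
Proof.
move=> lam0; have rl := obs_part_regular pX lX lam0.
have hs := resolvent_supp pX lX rl; move: (rl); rewrite regular_ptE => ul.
have [Xs _] := pX.
rewrite /ss_tf mulmxDr !mulmxA => vZ.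
set w := v *m cmx L *m invmx (lam%:M - cmx (obs_part A X)) in vZ.
have wS : w *m cmx (supp X) = w by rewrite /w -!mulmxA (mulmxA (cmx L)) hs.
have wA : w *m cmx A = lam *: w - v *m cmx L.
  have -> : w *m cmx A = w *m cmx (obs_part A X) by rewrite cmxM mulmxA wS.
  have : w *m (lam%:M - cmx (obs_part A X)) = v *m cmx L by rewrite /w mulmxKV.
  by rewrite mulmxBr mul_mx_scalar => <-; rewrite opprB addrC subrK.
have wB : w *m cmx B = - (v *m cmx W) by apply/eqP; rewrite -subr_eq0 opprK addrC vZ.
clearbody w.
pose w1 := (re_mx w)^T; pose w2 := (im_mx w)^T.
pose v1 := (re_mx v)^T; pose v2 := (im_mx v)^T.
have wX q : q *m supp X = q -> exists p, q^T = X *m p.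
  by move=> qS; exists (q *m pinvmx X)^T; rewrite -{1}Xs -trmx_mul -mulmxA [_ *m X]/(supp X) qS.
have [p1 w1E] : exists p, w1 = X *m p by apply: wX; rewrite -re_mxMr wS.
have [p2 w2E] : exists p, w2 = X *m p by apply: wX; rewrite -im_mxMr wS.
have [eps eps0 /= [pY dY]] : exists2 eps, 0 < eps &
    let Y := X - eps *: (w1 *m w1^T + w2 *m w2^T) in psd Y /\ dissip A B C D Y.
  apply: (@dissip_reflect (complex.Re lam) (complex.Im lam) w1 w2 p1 p2 v1 v2) => //.
  - have /(congr1 trmx) := congr1 (@re_mx R _ _) wA.
    by rewrite !re_mxE trmx_mul => ->; rewrite !linearB /= !linearZ /= trmx_mul.
  - have /(congr1 trmx) := congr1 (@im_mx R _ _) wA.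
    by rewrite !im_mxE trmx_mul => ->; rewrite linearB linearD /= !linearZ /= trmx_mul.
  - have /(congr1 trmx) := congr1 (@re_mx R _ _) wB.
    by rewrite !re_mxE trmx_mul => ->; rewrite linearN /= trmx_mul.
  have /(congr1 trmx) := congr1 (@im_mx R _ _) wB.
  by rewrite !im_mxE trmx_mul => ->; rewrite linearN /= trmx_mul.
have hw x : dot w1 x ^+ 2 + dot w2 x ^+ 2 <= 0.
  have h (q : 'cV[R]_d) : dot x ((q *m q^T) *m x) = dot q x ^+ 2.
    have -> : q *m q^T *m x = dot q x *: q.
      by rewrite -mulmxA [q^T *m x]mx11_scalar mul_mx_scalar.
    by rewrite dotZr (dotC x) expr2.
  have := minX pY dY x; rewrite mulmxBl -scalemxAl mulmxDl !dotB !h.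
  by rewrite lerBDl gerDr pmulr_rle0.
have w10 : w1 = 0.
  by apply: dot_eq0; have := hw w1; have := sqr_ge0 (dot w2 w1); have := sqr_ge0 (dot w1 w1); nra.
have w20 : w2 = 0.
  by apply: dot_eq0; have := hw w2; have := sqr_ge0 (dot w1 w2); have := sqr_ge0 (dot w2 w2); nra.
have w0 : w = 0.
  apply: cmx_eqP; apply: trmx_inj; first by rewrite -/w1 w10 re_mx0 trmx0.
  by rewrite -/w2 w20 im_mx0 trmx0.
have vL : v *m cmx L = 0 by move: wA; rewrite w0 mul0mx scaler0 sub0r => /eqP; rewrite eq_sym oppr_eq0 => /eqP.
have vW : v *m cmx W = 0 by move: wB; rewrite w0 mul0mx => /eqP; rewrite eq_sym oppr_eq0 => /eqP.
have z (q : 'rV[R]_r) : q *m L = 0 -> q *m W = 0 -> q = 0.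
  move=> qL qW; apply: (row_free_inj fX).
  by rewrite mul0mx mul_mx_row qL qW row_mx0.
apply: cmx_eqP; rewrite ?(re_mx0, im_mx0); apply: z.
- by rewrite -re_mxMr vL re_mx0.
- by rewrite -re_mxMr vW re_mx0.
- by rewrite -im_mxMr vL im_mx0.
by rewrite -im_mxMr vW im_mx0.
Qed.

(** The quotients are those of the transfer function of [obs_part], whose characteristic polynomial
    has no zero in the open right half-plane even when that of [A] does. *)
Lemma minimal_spectral_factor :
  spectral_factor A (ss_tf A B L W)
    (fun xi => 1%:M - rstar (ss_tf A B C D) xi *m ss_tf A B C D xi).
Proof.
split=> [xi rx ry|]; first exact: (lure_spectral pX lX).
have [P PE] := tf_poly (obs_part A X) B L W.
exists P, (fun _ _ => char_poly (cmx (obs_part A X))); split.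
- by move=> _ _ lam; rewrite gt0_Re => lam0; rewrite /root horner_char_poly; exact: (obs_part_regular pX lX lam0).
- move=> i j xi rx; rewrite /root => rx'.
  have {}rx' : regular_pt (obs_part A X) xi by rewrite /regular_pt -horner_char_poly.
  by rewrite (ss_tf_obs_part pX lX) // PE.
move=> lam; rewrite gt0_Re => lam0; have rl := obs_part_regular pX lX lam0.
have -> : \matrix_(i, j) ((P i j).[lam] / (char_poly (cmx (obs_part A X))).[lam]) =
    ss_tf (obs_part A X) B L W lam.
  by apply/matrixP => i j; rewrite mxE PE.
apply/eqP; rewrite -[_ == _]/(row_free _) -kermx_eq0; apply/eqP/row_matrixP => i.
by rewrite row0; apply: (minimal_full_rank lam0 _); rewrite -row_mul mulmx_ker row0.
Qed.
End SpectralFactor.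

Lemma quad_ge0_lin (R : realFieldType) (a b : R) :
  (forall t, 0 <= t ^+ 2 * a + t * b) -> b = 0.
Proof.
move=> h; apply/eqP; apply: contraT => b0.
have a1 : 0 < `|a| + 1 by rewrite ltr_wpDl.
(* At this point the form equals [(b / (|a| + 1))^2 (a - |a| - 1)], negative unless [b = 0]. *)
have := h (- b / (`|a| + 1)).
have -> : (- b / (`|a| + 1)) ^+ 2 * a + - b / (`|a| + 1) * b =
   (b / (`|a| + 1)) ^+ 2 * (a - (`|a| + 1)) by field; rewrite lt0r_neq0.
have b1 : 0 < (b / (`|a| + 1)) ^+ 2.
  by rewrite exprn_even_gt0 //= mulf_neq0 // invr_eq0 lt0r_neq0.
rewrite pmulr_rge0 //; have := ler_norm a; lra.
Qed.

(** * Uniqueness of the matrix with a spectral factor *)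

Section Uniqueness.
Variables (R : realType) (d n m : nat).
Variables (A : 'M[R]_d) (B : 'M[R]_(d, n)) (C : 'M[R]_(m, d)) (D : 'M[R]_(m, n)).
Variables (X : 'M[R]_d) (r : nat) (L : 'M[R]_(r, d)) (W : 'M[R]_(r, n)).
Hypothesis pX : psd X.
Hypothesis lX : lure A B C D X L W.
Variable F : R[i] -> 'M[R[i]]_n.
Hypothesis sX : spectral_factor A (ss_tf A B L W) F.

(** The hypothesis speaks of some quotients [P / Q] that agree with [Z] only at regular points of
    [A]. They are identified with the transfer function of [obs_part] as rational functions, and
    thus at [lam], which may be an eigenvalue of [A]. *)
Lemma spectral_full_rank lam (v : 'rV[R[i]]_r) : 0 < complex.Re lam ->
  v *m ss_tf (obs_part A X) B L W lam = 0 -> v = 0.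
Proof.
move=> lam0 vZ; have [_ [P [Q [Q0 PQ PQr]]]] := sX.
have {}Q0 i j : ~~ root (Q i j) lam by apply: Q0; rewrite gt0_Re.
have {}PQr := PQr lam; rewrite gt0_Re in PQr; have {}PQr := PQr lam0.
have [P' P'E] := tf_poly (obs_part A X) B L W.
have rl := obs_part_regular pX lX lam0.
set q := char_poly (cmx (obs_part A X)) in P'E *.
have qreg x : q.[x] != 0 -> regular_pt (obs_part A X) x.
  by rewrite /regular_pt -horner_char_poly.
have ql : q.[lam] != 0 by rewrite horner_char_poly.
have q0 : q != 0 := monic_neq0 (char_poly_monic _).
pose chi := char_poly (cmx A).
have chireg x : chi.[x] != 0 -> regular_pt A x by rewrite /regular_pt -horner_char_poly.
have chi0 : chi != 0 := monic_neq0 (char_poly_monic _).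
clearbody q chi.
have PE i j : P i j * q = P' i j * Q i j.
  apply/eqP; rewrite -subr_eq0.
  (* The factor [Q i j * q * chi] vanishes at every point where the two quotients cannot be
     compared. *)
  have : (P i j * q - P' i j * Q i j) * (Q i j * q * chi) = 0.
    apply: poly_eq0_all => x; rewrite hornerM !hornerM.
    have [->|Qx] := eqVneq (Q i j).[x] 0; first by rewrite !(mul0r, mulr0).
    have [->|qx] := eqVneq q.[x] 0; first by rewrite !(mul0r, mulr0).
    have [->|Ax] := eqVneq chi.[x] 0; first by rewrite !(mul0r, mulr0).
    have rA := chireg _ Ax; have rO := qreg _ qx.
    have : (P i j).[x] / (Q i j).[x] = (P' i j).[x] / q.[x].
      by rewrite P'E // -(ss_tf_obs_part pX lX) // PQ.
    move/(congr1 (fun z => z * (Q i j).[x] * q.[x])); rewrite mulfVK //.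
    rewrite mulrAC mulfVK // => e.
    by rewrite hornerD hornerN !hornerM e subrr mul0r.
  move/eqP; rewrite !mulf_eq0 => /or3P[//|/orP[/eqP Qz|]|].
  - by have := Q0 i j; rewrite Qz root0.
  - by rewrite (negPf q0).
  by rewrite (negPf chi0).
have ZE : \matrix_(i, j) ((P i j).[lam] / (Q i j).[lam]) = ss_tf (obs_part A X) B L W lam.
  apply/matrixP => i j; rewrite mxE -P'E //.
  have Ql : (Q i j).[lam] != 0 by exact: Q0.
  apply: (mulIf Ql); rewrite mulfVK // mulrAC; apply: (mulIf ql).
  by rewrite mulfVK // -!hornerM PE.
have Zf : row_free (ss_tf (obs_part A X) B L W lam) by rewrite /row_free -ZE PQr.
by apply: (row_free_inj Zf); rewrite mul0mx.
Qed.

(** The rank condition as absence of zeros of the system pencil: [w] is recovered from [v] by the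
    resolvent of [obs_part], and then [v Z(lam) = 0]. *)
Lemma pencil_left_kernel lam (w : 'rV[R[i]]_d) (v : 'rV[R[i]]_r) :
  0 < complex.Re lam -> w *m cmx (supp X) = w ->
  w *m cmx A = lam *: w - v *m cmx L -> w *m cmx B = - (v *m cmx W) ->
  v = 0 /\ w = 0.
Proof.
move=> lam0 wS wA wB; have := obs_part_regular pX lX lam0; rewrite regular_ptE => ul.
have wE : w = v *m cmx L *m invmx (lam%:M - cmx (obs_part A X)).
  rewrite -[LHS](mulmxK ul); congr (_ *m _).
  by rewrite mulmxBr mul_mx_scalar cmxM mulmxA wS wA opprB addrC subrK.
have v0 : v = 0.
  apply: (spectral_full_rank lam0).
  by rewrite /ss_tf mulmxDr !mulmxA -wE wB subrr.
by split=> //; rewrite wE v0 !mul0mx.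
Qed.

(** The real case at the point 1; one point of the open right half-plane suffices for the rank
    arguments of [gap_eq0]. *)
Lemma pencil_left_kernel1 (w : 'rV[R]_d) (v : 'rV[R]_r) :
  w *m supp X = w -> w *m A = w - v *m L -> w *m B = - (v *m W) -> v = 0 /\ w = 0.
Proof.
move=> wS wA wB.
have [||||v0 w0] := @pencil_left_kernel 1 (cmx w) (cmx v).
- exact: ltr01.
- by rewrite -cmxM wS.
- by rewrite scale1r -!cmxM wA /cmx map_mxB.
- by rewrite -!cmxM wB /cmx map_mxN.
by rewrite -[v]re_cmx -[w]re_cmx v0 w0 !re_mx0.
Qed.

Hypothesis kX : forall z : 'cV[R]_d,
  (forall k : 'I_d, C *m (A ^+ k) *m z = 0) -> X *m z = 0.

(* Otherwise [s1] and [s2] would span, modulo [ker X], an undamped mode of [A], which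
   the Lyapunov equation for [X] makes unobservable. *)
Lemma no_undamped_mode b (s1 s2 : 'cV[R]_d) :
  A^T *m (X *m s1) = - b *: (X *m s2) -> A^T *m (X *m s2) = b *: (X *m s1) ->
  X *m s1 = 0 /\ X *m s2 = 0.
Proof.
move=> A1 A2; have [Xs _] := pX; have [E1 _ _] := lX.
have dis s : 2 * dot (A^T *m (X *m s)) s + dot (C *m s) (C *m s) + dot (L *m s) (L *m s) = 0.
  have := lure_dissip Xs lX s 0; rewrite /supply !mulmx0 !addr0 dot0r.
  by rewrite dot_mulr Xs dot_mulr; lra.
have Xsym : dot (X *m s2) s1 = dot (X *m s1) s2 by rewrite dot_mull Xs dotC.
have := dis s1; have := dis s2; rewrite A1 A2 !dotZl Xsym => h2 h1.
have c1 := dot_ge0 (C *m s1); have c2 := dot_ge0 (C *m s2).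
have l1 := dot_ge0 (L *m s1); have l2 := dot_ge0 (L *m s2).
have C1 : C *m s1 = 0 by apply: dot_eq0; lra.
have C2 : C *m s2 = 0 by apply: dot_eq0; lra.
have L1 : L *m s1 = 0 by apply: dot_eq0; lra.
have L2 : L *m s2 = 0 by apply: dot_eq0; lra.
have XA (s : 'cV_d) : C *m s = 0 -> L *m s = 0 -> X *m (A *m s) = - (A^T *m (X *m s)).
  move=> Cs Ls; have := congr1 (mulmx^~ s) E1.
  rewrite /= !mulmxBl !mulNmx -!mulmxA Cs Ls !mulmx0 subr0 => /eqP.
  by rewrite subr_eq0 => /eqP <-.
have XA1 := XA _ C1 L1; have XA2 := XA _ C2 L2; rewrite A1 in XA1; rewrite A2 in XA2.
(* Modulo [ker X], the span of [s1] and [s2] is invariant under [A], and [C] vanishes on it; hence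
   all [C A^k] vanish on it. *)
have span s al be : X *m s = al *: (X *m s1) + be *: (X *m s2) ->
    C *m s = 0 /\ exists al' be', X *m (A *m s) = al' *: (X *m s1) + be' *: (X *m s2).
  move=> e; have [|Cy _ XAy] := psd_supply_ker pX lX (x := s - (al *: s1 + be *: s2)).
    by rewrite mulmxBr e mulmxDr -!scalemxAr subrr.
  split; first by move: Cy; rewrite mulmxBr mulmxDr -!scalemxAr C1 C2 !scaler0 addr0 subr0.
  exists (- (be * b)), (al * b); move: XAy.
  rewrite mulmxBr mulmxBr !mulmxDr -!scalemxAr XA1 XA2 => /eqP.
  by rewrite subr_eq0 => /eqP ->; apply/matrixP => i j; rewrite !mxE; ring.
have spank s k : (exists al be, X *m s = al *: (X *m s1) + be *: (X *m s2)) ->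
    C *m (A ^+ k *m s) = 0.
  elim: k s => [|k IH] s [al [be e]]; have [Cs XAs] := span _ _ _ e.
    by rewrite expr0 mul1mx.
  by rewrite exprSr -[_ * A]/(_ *m A) -mulmxA; exact: IH.
split; apply: kX => k; rewrite -mulmxA; apply: spank.
  by exists 1, 0; rewrite scale1r scale0r addr0.
by exists 0, 1; rewrite scale1r scale0r add0r.
Qed.

Variable Y : 'M[R]_d.
Hypothesis pY : psd Y.
Hypothesis dY : dissip A B C D Y.
Hypothesis YX : forall x, dot x (Y *m x) <= dot x (X *m x).

Let Del : 'M[R]_d := X - Y.

Lemma gap_psd : psd Del.
Proof.
have [[Xs _] [Ys _]] := (pX, pY).
split=> [|x]; first by rewrite /Del; apply/matrixP => i j; rewrite !mxE -{1}Xs -{1}Ys !mxE.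
by rewrite mulmxBl !dotB subr_ge0.
Qed.

(** On [ker X] the form of [Del] equals [- x^T Y x <= 0], so [ker X] lies in [ker Del]. *)
Lemma gap_supp : Del *m supp X = Del.
Proof.
apply: supp_subP => x Xx; apply: psd_ker gap_psd _.
by rewrite mulmxBl !dotB Xx dot0r sub0r oppr_le0; have [_] := pY; exact.
Qed.

Lemma gap_quad x u :
  0 <= dot (L *m x + W *m u) (L *m x + W *m u) + 2 * dot x (Del *m (A *m x + B *m u)).
Proof.
have [Xs _] := pX; have := lure_dissip Xs lX x u; have := dY x u.
by rewrite [Del *m _]mulmxBl !dotB; lra.
Qed.

(** Move the state to [x + t g] in [gap_quad]: the output is then of order [t], so its square is of
    order [t^2], and the coefficient [2 |g|^2] of [t] has to vanish. *)
Lemma gap_ker (x : 'cV_d) (u : 'cV_n) : Del *m x = 0 -> L *m x + W *m u = 0 -> Del *m (A *m x + B *m u) = 0.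
Proof.
move=> Dx e0; set g := Del *m _; apply: dot_eq0.
suff : 2 * dot g g = 0 by lra.
apply: (@quad_ge0_lin _ (dot (L *m g) (L *m g) + 2 * dot g (Del *m (A *m g)))) => t.
have := gap_quad (x + t *: g) u.
have -> : L *m (x + t *: g) + W *m u = t *: (L *m g).
  by rewrite mulmxDr addrAC e0 add0r -scalemxAr.
have -> : A *m (x + t *: g) + B *m u = (A *m x + B *m u) + t *: (A *m g).
  by rewrite mulmxDr addrAC -scalemxAr.
have [Ds _] := gap_psd.
rewrite mulmxDr -/g -scalemxAr !dotB.
have -> : dot x g = 0 by rewrite /g dot_mulr Ds Dx dot0l.
have -> : dot x (Del *m (A *m g)) = 0 by rewrite dot_mulr Ds Dx dot0l.
move=> h; apply: le_trans h _; rewrite le_eqVlt; apply/orP; left; apply/eqP; ring.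
Qed.

(* The dynamics of [x] modulo [ker Del] is driven by the output [L x + W u] alone:
   [T] is its state matrix (acting on row vectors) and [G] its input matrix. *)
Lemma gap_inner_dynamics : exists (T : 'M[R]_d) (G : 'M[R]_(d, r)),
  [/\ T *m supp Del = T, Del *m B = G *m W &
      forall w : 'rV[R]_d, w *m supp Del = w ->
        w *m A = w *m T + w *m pinvmx Del *m G *m L].
Proof.
pose K := 1%:M - supp Del.
have DK : Del *m K = 0 by rewrite mulmxBr mulmx1 mulmx_supp subrr.
(* The columns of [K] span [ker Del], so [gap_ker] says that [ker N2] lies in [ker N1]; hence [N1]
   factors through [N2], by [G]. *)
pose N2 := row_mx (L *m K) W; pose N1 := row_mx (Del *m A *m K) (Del *m B).
have := @supp_subP _ _ _ N2 _ N1.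
rewrite /supp mulmxA; set G := N1 *m pinvmx N2 => NG.
have {NG} : G *m N2 = N1.
  apply: NG => z; rewrite -[z]vsubmxK !mul_row_col -!mulmxA => e.
  by rewrite -mulmxDr gap_ker // mulmxA ?DK ?mul0mx // -mulmxA.
rewrite mul_mx_row => /eq_row_mx[GL GW].
exists (pinvmx Del *m (Del *m A - G *m L)), G; split=> //.
  rewrite -mulmxA; congr (_ *m _); apply/eqP; rewrite eq_sym -subr_eq0.
  by rewrite -{1}[Del *m A - _]mulmx1 -mulmxBr mulmxBl -mulmxA -(mulmxA G) GL mulmxA subrr.
move=> w wS; have e : w *m pinvmx Del *m Del = w by rewrite -mulmxA.
by rewrite [w *m (pinvmx Del *m _)]mulmxA mulmxBr (mulmxA _ Del A) (mulmxA _ G L) e subrK.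
Qed.

(** Take a left eigenvector [w] of [T] in the row space of [Del], with eigenvalue [a + i b]. The
    pencil lemmas give [a <= 0] and allow the output [L z + W u] to be prescribed together with
    [Del z]. A suitable choice turns the sum of two instances of [gap_quad] into [2 a (w1^T z1 +
    w2^T z2) - |v1|^2 - |v2|^2 >= 0]. So [v1], [v2] and [a] vanish, leaving an undamped mode. *)
Lemma gap_eq0 : Del = 0.
Proof.
have [T [G [TS DB TA]]] := gap_inner_dynamics.
have [Ds D0] := gap_psd; have [Xs X0] := pX.
have SX : supp Del *m supp X = supp Del by rewrite /supp -(mulmxA _ Del) -/(supp X) gap_supp.
have wB (w : 'rV[R]_d) : w *m supp Del = w -> w *m B = w *m pinvmx Del *m G *m W.
  by move=> wS; rewrite -(mulmxA _ G) -DB (mulmxA _ Del) -(mulmxA w) wS.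
(* A left eigenvector of [T] for the eigenvalue 1, paired with minus its input row, would lie in the
   left kernel of the pencil. *)
have uT : 1%:M - T \in unitmx.
  rewrite unitmxE unitfE; apply/negP => /det0P[w w0].
  rewrite mulmxBr mulmx1 => /eqP; rewrite subr_eq0 => /eqP wT.
  have wS : w *m supp Del = w by rewrite wT -mulmxA TS.
  have [|||_ w00] := @pencil_left_kernel1 w (- (w *m pinvmx Del *m G)); last by rewrite w00 eqxx in w0.
  - by rewrite -wS -mulmxA SX.
  - by rewrite TA // -wT mulNmx opprK.
  by rewrite wB // mulNmx opprK.
pose K := 1%:M - supp Del.
(* If [b] annihilates [(L K, W)], then [b L] lies in the row space of [Del], and
   [w = b L (1 - T)^-1] completes [b] to a left null vector of the pencil. *)
have fK : row_free (row_mx (L *m K) W).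
  rewrite -kermx_eq0; apply/eqP/row_matrixP => i; rewrite row0.
  set b := row i _.
  have : b *m row_mx (L *m K) W = 0 by rewrite -row_mul mulmx_ker row0.
  rewrite mul_mx_row -row_mx0 => /eq_row_mx[bL bW].
  have {}bL : b *m L *m supp Del = b *m L.
    by apply/eqP; rewrite eq_sym -subr_eq0 -{1}[_ *m L]mulmx1 -mulmxBr -mulmxA bL.
  pose w := b *m L *m invmx (1%:M - T).
  have wT : w = b *m L + w *m T.
    have : w *m (1%:M - T) = b *m L by rewrite /w mulmxKV.
    by rewrite mulmxBr mulmx1 => <-; rewrite subrK.
  have wS : w *m supp Del = w by rewrite wT mulmxDl bL -mulmxA TS.
  have [||| v0 w0] := @pencil_left_kernel1 w (b - w *m pinvmx Del *m G).
  - by rewrite -wS -mulmxA SX.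
  - have -> : w *m A = w - b *m L + w *m pinvmx Del *m G *m L.
      by rewrite TA //; congr (_ + _); rewrite {2}wT addrAC subrr add0r.
    by rewrite mulmxBl opprB [RHS]addrA addrAC.
  - by rewrite wB // mulmxBl bW sub0r opprK.
  by move: v0; rewrite w0 !mul0mx subr0.
have solve (p : 'cV[R]_d) (v : 'cV[R]_r) : exists (z : 'cV_d) (u : 'cV_n), Del *m z = Del *m p /\ L *m z + W *m u = v.
  have /row_freeP[S KS] := fK.
  pose c := S *m (v - L *m p).
  have := congr1 (mulmx^~ (v - L *m p)) KS; rewrite /= mul1mx -mulmxA -/c.
  rewrite -[c]vsubmxK mul_row_col => e.
  exists (p + K *m usubmx c), (dsubmx c); split.
    by rewrite mulmxDr mulmxA mulmxBr mulmx1 mulmx_supp subrr mul0mx addr0.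
  by rewrite mulmxDr -addrA mulmxA e addrC subrK.
apply/eqP; apply: contraT => Dn0.
(* [T] is compressed to the row space of [Del], of positive dimension, so that its eigenvector is
   nonzero modulo [ker Del]. *)
pose V := row_base Del.
have VS : V *m supp Del = V by rewrite /supp mulmxA mulmxKpV // /V eq_row_base.
have V1 : V *m pinvmx V = 1%:M by apply: mulmxVp; exact: row_base_free.
have [mu /eigenvalueP[y yT y0]] : exists mu, eigenvalue (cmx (V *m T *m pinvmx V)) mu.
  by apply: eigenvalue_closed; rewrite lt0n mxrank_eq0.
have VT : V *m T *m pinvmx V *m V = V *m T.
  apply: mulmxKpV; rewrite /V eq_row_base -TS /supp !mulmxA; exact: submxMl.
pose w := y *m cmx V.
have wT : w *m cmx T = mu *: w.
  by rewrite /w -mulmxA -cmxM -VT cmxM mulmxA yT scalemxAl.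
have wS : w *m cmx (supp Del) = w by rewrite /w -mulmxA -cmxM VS.
have wn0 : w != 0.
  apply: contraNneq y0 => w0; have : w *m cmx (pinvmx V) = 0 by rewrite w0 mul0mx.
  by rewrite /w -mulmxA -cmxM V1 /cmx map_mx1 mulmx1 => ->.
clearbody w.
have S1 : re_mx w *m supp Del = re_mx w by rewrite -re_mxMr wS.
have S2 : im_mx w *m supp Del = im_mx w by rewrite -im_mxMr wS.
have T1 : re_mx w *m T = complex.Re mu *: re_mx w - complex.Im mu *: im_mx w.
  by rewrite -re_mxMr wT re_mxZ.
have T2 : im_mx w *m T = complex.Re mu *: im_mx w + complex.Im mu *: re_mx w.
  by rewrite -im_mxMr wT im_mxZ.
pose v1 := re_mx w *m pinvmx Del *m G; pose v2 := im_mx w *m pinvmx Del *m G.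
have mu0 : complex.Re mu <= 0.
  rewrite leNgt; apply/negP => mu0; 
  have [|||_ w0] := @pencil_left_kernel mu w (- (w *m cmx (pinvmx Del) *m cmx G)) mu0;
    last by rewrite w0 eqxx in wn0.
  - by rewrite -wS -mulmxA -cmxM SX.
  - rewrite mulNmx opprK -wT -!mulmxA -!cmxM.
    apply: cmx_eqP; first by rewrite !re_mxE TA // !mulmxA.
    by rewrite !im_mxE TA // !mulmxA.
  rewrite mulNmx opprK -!mulmxA -!cmxM.
  by apply: cmx_eqP; rewrite !(re_mxMr, im_mxMr) wB // !mulmxA.
have tr1 (w' : 'rV[R]_d) : w' *m supp Del = w' -> exists p, w'^T = Del *m p.
  by move=> e; exists (w' *m pinvmx Del)^T; rewrite -{1}Ds -trmx_mul -mulmxA -/(supp Del) e.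
have [p1 w1E] := tr1 _ S1; have [p2 w2E] := tr1 _ S2.
set a := complex.Re mu in mu0 T1 T2; set b := complex.Im mu in T1 T2.
pose w1 := (re_mx w)^T; pose w2 := (im_mx w)^T.
have A1 : A^T *m w1 = a *: w1 + (- b) *: w2 - L^T *m (- v1)^T.
  rewrite -!trmx_mul TA // -/v1 T1 mulNmx.
  by move: (v1 *m L) => q; apply/matrixP => i j; rewrite !mxE; ring.
have A2 : A^T *m w2 = a *: w2 + b *: w1 - L^T *m (- v2)^T.
  rewrite -!trmx_mul TA // -/v2 T2 mulNmx.
  by move: (v2 *m L) => q; apply/matrixP => i j; rewrite !mxE; ring.
have B1 : B^T *m w1 = - (W^T *m (- v1)^T) by rewrite -!trmx_mul wB // mulNmx -/v1; move: (v1 *m W) => q; apply/matrixP => i j; rewrite !mxE opprK.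
have B2 : B^T *m w2 = - (W^T *m (- v2)^T) by rewrite -!trmx_mul wB // mulNmx -/v2; move: (v2 *m W) => q; apply/matrixP => i j; rewrite !mxE opprK.
(* The output is set to the very vector that enters the drift of [w1], so [|v|^2 - 2 v^T v] leaves
   [- |v|^2]. *)
have [z1 [u1 [Dz1 e1]]] := solve p1 (- v1)^T.
have [z2 [u2 [Dz2 e2]]] := solve p2 (- v2)^T.
rewrite -w1E -/w1 in Dz1; rewrite -w2E -/w2 in Dz2.
have := gap_quad z1 u1; have := gap_quad z2 u2.
rewrite e1 e2 ![dot _ (Del *m _)]dot_mulr Ds Dz1 Dz2.
rewrite (dot_drift z1 u1 A1 B1) (dot_drift z2 u2 A2 B2) e1 e2.
have -> : dot w2 z1 = dot w1 z2 by rewrite -Dz1 -Dz2 dot_mull Ds dotC.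
have d1 : 0 <= dot w1 z1 by rewrite -Dz1 dotC.
have d2 : 0 <= dot w2 z2 by rewrite -Dz2 dotC.
have n1 := dot_ge0 (- v1)^T; have n2 := dot_ge0 (- v2)^T.
move=> h2 h1.
have ad1 : a * dot w1 z1 <= 0 by rewrite mulr_le0_ge0.
have ad2 : a * dot w2 z2 <= 0 by rewrite mulr_le0_ge0.
have v10 : (- v1)^T = 0 by apply: dot_eq0; lra.
have v20 : (- v2)^T = 0 by apply: dot_eq0; lra.
have a0 : a = 0.
  apply/eqP; apply: contraT => an0.
  have {}an0 : a < 0 by rewrite lt_neqAle an0.
  have z (w' z : 'cV[R]_d) : Del *m z = w' -> 0 <= a * dot w' z -> w' = 0.
    move=> <-; rewrite nmulr_rge0 // => h; apply: psd_ker gap_psd _.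
    by rewrite dotC.
  case/eqP: wn0; apply: cmx_eqP; apply: trmx_inj; rewrite ?re_mx0 ?im_mx0 trmx0.
    by apply: (z _ z1) => //; rewrite -/w1; lra.
  by apply: (z _ z2) => //; rewrite -/w2; lra.
rewrite v10 mulmx0 subr0 a0 scale0r add0r in A1.
rewrite v20 mulmx0 subr0 a0 scale0r add0r in A2.
(* The range of [Del] lies in that of [X]; this provides the [s1] and [s2] of [no_undamped_mode]. *)
have tX (p : 'cV[R]_d) : Del *m p = X *m ((pinvmx X)^T *m (Del *m p)).
  have {1}<- : (Del *m supp X)^T = Del by rewrite gap_supp.
  by rewrite /supp !trmx_mul Xs Ds !mulmxA.
case/eqP: wn0; have [|| h1' h2'] := @no_undamped_mode b ((pinvmx X)^T *m w1) ((pinvmx X)^T *m w2).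
- by rewrite /w1 /w2 w1E w2E -!tX -w1E -w2E.
- by rewrite /w1 /w2 w1E w2E -!tX -w1E -w2E.
apply: cmx_eqP; apply: trmx_inj; rewrite ?re_mx0 ?im_mx0 trmx0.
  by rewrite w1E tX -w1E.
by rewrite w2E tX -w2E.
Qed.
End Uniqueness.

(** * Primitives of locally integrable functions *)

Local Open Scope classical_set_scope.

Section LocallyIntegrable.
Variable R : realType.
Notation mu := (@lebesgue_measure R).
Implicit Types (f g F G : R -> R) (a b c s t eps del : R).

Definition locint f := measurable_fun setT f /\
  forall a b : R, mu.-integrable `[a, b] (EFin \o f).

(** For [b < a] the interval is empty and the integral is 0, not the opposite of the reversed one;
    hence the order hypotheses in what follows. *)
Definition itg f (a b : R) : R := Rintegral mu `[a, b] f.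

Lemma lebesgue_measure_cc a b : a <= b -> mu `[a, b] = (b - a)%:E.
Proof.
rewrite /= lebesgue_measure_itv /= lte_fin.
by case: ltgtP => // -> _; rewrite subrr.
Qed.

Lemma locintD f g : locint f -> locint g -> locint (fun t => f t + g t).
Proof.
move=> [mf fi] [mg gi]; split; first exact: measurable_funD.
by move=> a b; apply: eq_integrable (integrableD _ (fi a b) (gi a b)).
Qed.

Lemma locintZ c f : locint f -> locint (fun t => c * f t).
Proof.
move=> [mf fi]; split; first by apply: measurable_funM => //; exact: measurable_cst.
by move=> a b; apply: eq_integrable (integrableZl _ c (fi a b)).
Qed.

Lemma locint_bounded f : measurable_fun setT f ->
  (forall a b, exists M : R, forall t, a <= t <= b -> `|f t| <= M) -> locint f.
Proof.
move=> mf bf; split=> // a b; apply: measurable_bounded_integrable => //.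
- rewrite /= lebesgue_measure_itv /=; case: ifP => // _.
  by rewrite -EFinD ltry.
- exact: measurable_funTS.
have [M fM] := bf a b; exists M; split; first exact: num_real.
move=> N MN t /=; rewrite in_itv /= => tab.
exact: (le_trans (fM t tab) (ltW MN)).
Qed.

Lemma locint_cst c : locint (fun _ => c).
Proof. by apply: locint_bounded => [|a b]; [exact: measurable_cst | exists `|c|]. Qed.

Lemma locint_sum I (s : seq I) (f : I -> R -> R) :
  (forall i, locint (f i)) -> locint (fun t => \sum_(i <- s) f i t).
Proof.
move=> fi; elim: s => [|i s IH].
  by under eq_fun do rewrite big_nil; exact: locint_cst.
under eq_fun do rewrite big_cons; exact: locintD.
Qed.

Lemma locint_norm f : locint f -> locint (fun t => `|f t|).
Proof.
move=> [mf fi]; split; first exact: measurableT_comp.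
by move=> a b; exact: integrable_norm.
Qed.

Lemma locint_le f g : measurable_fun setT f -> locint g ->
  (forall t, `|f t| <= g t) -> locint f.
Proof.
move=> mf [mg gi] fg; split=> // a b; apply: le_integrable (gi a b) => //.
  exact/measurable_EFinP/measurable_funTS.
by move=> t _ /=; rewrite lee_fin (le_trans (fg t)) // ler_norm.
Qed.

Lemma locintM f g : locint f -> measurable_fun setT g ->
  (forall a b, exists M : R, forall t, a <= t <= b -> `|g t| <= M) ->
  locint (fun t => f t * g t).
Proof.
move=> [mf fi] mg bg; split; first exact: measurable_funM.
move=> a b; have [M gM] := bg a b.
have : mu.-integrable `[a, b] ((EFin \o f) \* (EFin \o g))%E.
  apply: integrableMl => //; first exact: measurable_funTS.
  exists M; split; first exact: num_real.
  move=> N MN t /=; rewrite in_itv /= => tab.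
  exact: (le_trans (gM t tab) (ltW MN)).
by apply: eq_integrable.
Qed.

Lemma eq_itg f g a b : (forall t, a <= t <= b -> f t = g t) -> itg f a b = itg g a b.
Proof. by move=> fg; apply: eq_Rintegral => t; rewrite inE /= in_itv /= => /fg. Qed.

Lemma itgD f g a b : locint f -> locint g ->
  itg (fun t => f t + g t) a b = itg f a b + itg g a b.
Proof. by move=> [_ fi] [_ gi]; exact: RintegralD. Qed.

Lemma itgZ c f a b : locint f -> itg (fun t => c * f t) a b = c * itg f a b.
Proof. by move=> [_ fi]; exact: RintegralZl. Qed.

Lemma itg_point f a : itg f a a = 0.
Proof. by rewrite /itg set_itv1 Rintegral_set1. Qed.

Lemma itg_sum I (s : seq I) (f : I -> R -> R) a b : (forall i, locint (f i)) ->
  itg (fun t => \sum_(i <- s) f i t) a b = \sum_(i <- s) itg (f i) a b.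
Proof.
move=> fi; elim: s => [|i s IH].
  rewrite big_nil -[RHS](mul0r (itg (fun _ => 1) a b)) -itgZ; last exact: locint_cst.
  by apply: eq_itg => t _; rewrite big_nil mul0r.
rewrite big_cons -IH -itgD //; last exact: locint_sum.
by apply: eq_itg => t _; rewrite big_cons.
Qed.

Lemma itg_le f g a b : locint f -> locint g ->
  (forall t, a <= t <= b -> f t <= g t) -> itg f a b <= itg g a b.
Proof.
by move=> [_ fi] [_ gi] fg; apply: le_Rintegral.
Qed.

Lemma itg_ge0 f a b : (forall t, 0 <= f t) -> 0 <= itg f a b.
Proof. by move=> f0; apply: Rintegral_ge0. Qed.

Lemma itg_cst c a b : a <= b -> itg (fun _ => c) a b = c * (b - a).
Proof.
by move=> ab; rewrite /itg Rintegral_cst //; congr (_ * _); rewrite [X in fine X]lebesgue_measure_cc.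
Qed.

Lemma itg_norm f a b : locint f -> `|itg f a b| <= itg (fun t => `|f t|) a b.
Proof. by move=> [_ fi]; exact: le_normr_Rintegral. Qed.

Lemma itg_cat f a b c : locint f -> a <= b -> b <= c ->
  itg f a c = itg f a b + itg f b c.
Proof.
move=> [_ fi] ab bc.
have h : mu.-integrable `]b, c] (EFin \o f).
  apply: integrableS (fi b c) => //; apply: subset_itvr; by rewrite bnd_simp.
rewrite /itg -(Rintegral_itv_obnd_cbnd h).
by rewrite -(@Rintegral_itvB _ f (BLeft a) (BRight c) b) ?bnd_simp // addrC subrK.
Qed.

(** Absolute continuity of the integral, applied to [f] cut off outside [[a, b]] so as to be
    integrable on the whole line. *)
Lemma itg_small f a b eps : locint f -> 0 < eps ->
  exists2 del, 0 < del & forall s t, a <= s -> s <= t -> t <= b -> t - s <= del ->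
    itg (fun r => `|f r|) s t <= eps.
Proof.
move=> [mf fi] e0.
have fT : mu.-integrable setT (EFin \o (f \_ (`[a, b] : set R))).
  have /integrable_mkcond : mu.-integrable `[a, b] (EFin \o f) by [].
  move=> /(_ (measurable_itv _)); apply: eq_integrable => // t _ /=.
  by rewrite !patchE; case: ifP.
have [d [d0 dP]] := integral_normr_continuous fT e0.
exists (d / 2); first by rewrite divr_gt0.
move=> s t as_ st tb ts.
have md : (mu `[s, t] < d%:E)%E by rewrite lebesgue_measure_cc // lte_fin; lra.
have := dP `[s, t] (measurable_itv _) md.
have -> : \int[mu]_(x in `[s, t]) `|(f \_ `[a, b]) x| = itg (fun r => `|f r|) s t.
  apply: eq_itg => r /andP[sr rt]; rewrite patchE ifT // inE /= in_itv /=.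
  by rewrite (le_trans as_ sr) (le_trans rt tb).
exact: ltW.
Qed.

(** [F] is locally absolutely continuous with derivative [f] almost everywhere, stated in integral
    form. *)
Definition prim f F := locint f /\ forall s t, s <= t -> F t - F s = itg f s t.

Lemma primD f g F G : prim f F -> prim g G ->
  prim (fun t => f t + g t) (fun t => F t + G t).
Proof.
move=> [fi fF] [gi gG]; split; first exact: locintD.
by move=> s t st; rewrite itgD // -fF // -gG //; ring.
Qed.

Lemma primZ c f F : prim f F -> prim (fun t => c * f t) (fun t => c * F t).
Proof.
move=> [fi fF]; split; first exact: locintZ.
by move=> s t st; rewrite itgZ // -fF //; ring.
Qed.

Lemma prim_sum I (s : seq I) (f F : I -> R -> R) : (forall i, prim (f i) (F i)) ->
  prim (fun t => \sum_(i <- s) f i t) (fun t => \sum_(i <- s) F i t).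
Proof.
move=> fF; split; first by apply: locint_sum => i; case: (fF i).
move=> a b ab; rewrite itg_sum => [|i]; last by case: (fF i).
by rewrite -sumrB; apply: eq_bigr => i _; case: (fF i) => _ ->.
Qed.

Lemma prim_modulus f F a b eps : prim f F -> 0 < eps ->
  exists2 del, 0 < del & forall s t, a <= s -> s <= t -> t <= b -> t - s <= del ->
    `|F t - F s| <= eps.
Proof.
move=> [fi fF] e0; have [d d0 dP] := itg_small a b fi e0.
exists d => // s t as_ st tb ts; rewrite fF //.
exact: (le_trans (itg_norm _ _ fi)) (dP s t as_ st tb ts).
Qed.

Lemma prim_continuous f F : prim f F -> continuous F.
Proof.
move=> fF x; apply/cvgrPdist_le => /= eps e0.
have [d d0 dP] := prim_modulus (x - 1) (x + 1) fF e0.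
exists (Num.min d 1) => /=; first by rewrite lt_min d0 ltr01.
move=> y; rewrite /ball_ /= lt_min => /andP[xyd xy1].
have [xy|yx] := leP x y.
  have {}xyd : y - x < d by move: xyd; rewrite distrC ger0_norm // subr_ge0.
  have {}xy1 : y - x < 1 by move: xy1; rewrite distrC ger0_norm // subr_ge0.
  by rewrite distrC; apply: dP => //; lra.
have {}xyd : x - y < d by move: xyd; rewrite gtr0_norm // subr_gt0.
have {}xy1 : x - y < 1 by move: xy1; rewrite gtr0_norm // subr_gt0.
by apply: dP => //; lra.
Qed.

Lemma prim_bounded f F a b : prim f F ->
  exists M : R, forall t, a <= t <= b -> `|F t| <= M.
Proof.
move=> [fi fF]; exists (`|F a| + itg (fun t => `|f t|) a b) => t /andP[at_ tb].
rewrite -[F t](subrK (F a)) addrC; apply: (le_trans (ler_normD _ _)); rewrite lerD2l fF //.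
apply: (le_trans (itg_norm _ _ fi)).
rewrite [leRHS](itg_cat (b := t)) //; last exact: locint_norm.
by rewrite lerDl; apply: itg_ge0.
Qed.

Lemma prim_measurable f F : prim f F -> measurable_fun setT F.
Proof. by move=> fF; apply: continuous_measurable_fun; exact: prim_continuous fF. Qed.

Lemma prim_locintM f g G : locint f -> prim g G -> locint (fun t => f t * G t).
Proof.
move=> fi gG; apply: locintM => //; first exact: prim_measurable gG.
by move=> a b; exact: prim_bounded gG.
Qed.

Lemma local_nonincreasing (h : R -> R) a b del : 0 < del ->
  (forall s t, a <= s -> s <= t -> t <= b -> t - s <= del -> h t <= h s) ->
  a <= b -> h b <= h a.
Proof.
move=> d0 hd ab.
have step n t : a <= t -> t <= b -> t <= a + del *+ n -> h t <= h a.
  elim: n t => [|n IH] t at_ tb tn.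
    by have -> : t = a by apply/eqP; rewrite eq_le at_ andbT -[a]addr0.
  have [|tn'] := leP t (a + del *+ n); first exact: IH.
  have an : a <= a + del *+ n by rewrite lerDl mulrn_wge0 // ltW.
  apply: le_trans (IH (a + del *+ n) an _ _) => //; last by rewrite (le_trans (ltW tn')).
  by apply: hd => //; [exact: ltW | move: tn; rewrite mulrS; lra].
have := archi_boundP (divr_ge0 _ (ltW d0)) => /(_ (b - a)).
rewrite subr_ge0 => /(_ ab) /ltW; rewrite ler_pdivrMr // => h1.
by apply: (step (Num.bound ((b - a) / del)) b) => //; rewrite -mulr_natl; lra.
Qed.

Lemma small_eq0 (x m : R) : 0 <= m -> (forall eps, 0 < eps -> `|x| <= eps * m) -> x = 0.
Proof.
move=> m0 h; apply/eqP; apply: contraT; rewrite -normr_gt0 => x0.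
have := h (`|x| / (2 * (m + 1))).
have -> : `|x| / (2 * (m + 1)) * m = `|x| * (m / (2 * (m + 1))) by field; rewrite lt0r_neq0 //; lra.
have m1 : 0 < 2 * (m + 1) by lra.
rewrite divr_gt0 // => /(_ isT); rewrite ler_pMr // ler_pdivlMr // mul1r; lra.
Qed.

(* [F] and [G] are only absolutely continuous: the product rule is obtained by summing
   its first-order error over a fine subdivision. *)
Lemma primM f g F G : prim f F -> prim g G ->
  prim (fun t => f t * G t + F t * g t) (fun t => F t * G t).
Proof.
move=> fF gG; have [fi Fe] := fF; have [gi Ge] := gG.
have fGi := prim_locintM fi gG.
have gFi : locint (fun t => F t * g t).
  by under eq_fun do rewrite mulrC; exact: prim_locintM gi fF.
have hi := locintD fGi gFi.
split=> // a b ab; set h := (fun t => _) in hi *.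
pose k t := `|f t| + `|g t|.
have ki : locint k by apply: locintD; exact: locint_norm.
have k0 t : 0 <= k t by rewrite addr_ge0.
pose P t := F t * G t - itg h a t.
suff : P b - P a = 0.
  by rewrite /P itg_point subr0 => /eqP; rewrite addrAC subr_eq0 => /eqP.
apply: (@small_eq0 _ (itg k a b)) => [|eps e0]; first exact: itg_ge0.
have [d1 d10 D1] := prim_modulus a b fF e0.
have [d2 d20 D2] := prim_modulus a b gG e0.
(* Freezing [G] at [t] and [F] at [s] makes the increment of the product exact; the integrand
   changes by at most [eps * k]. *)
have loc s t : a <= s -> s <= t -> t <= b -> t - s <= Num.min d1 d2 ->
    `|P t - P s| <= eps * itg k s t.
  move=> as_ st tb; rewrite le_min => /andP[ts1 ts2].
  have -> : P t - P s = itg (fun r => (G t * f r + F s * g r) + (- 1) * h r) s t.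
    rewrite itgD; [|by apply: locintD; exact: locintZ|exact: locintZ].
    rewrite itgD; [|exact: locintZ|exact: locintZ].
    rewrite !itgZ // -Fe // -Ge // /P (itg_cat (b := s) hi as_ st); ring.
  apply: le_trans (itg_norm _ _ _) _.
    by apply: locintD; [apply: locintD; exact: locintZ|exact: locintZ].
  rewrite -itgZ //; apply: itg_le.
  - apply: locint_norm.
    by apply: locintD; [apply: locintD; exact: locintZ|exact: locintZ].
  - exact: locintZ.
  move=> r /andP[sr rt].
  have -> : G t * f r + F s * g r + -1 * h r = f r * (G t - G r) - g r * (F r - F s).
    by rewrite /h; ring.
  apply: le_trans (ler_normB _ _) _; rewrite !normrM /k mulrDr !(mulrC eps).
  apply: lerD; apply: ler_wpM2l => //.
    by apply: D2 => //; [exact: le_trans sr | lra].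
  by apply: D1 => //; [exact: le_trans tb | lra].
have d0 : 0 < Num.min d1 d2 by rewrite lt_min d10.
have up : P b - eps * itg k a b <= P a - eps * itg k a a.
  apply: (@local_nonincreasing (fun t => P t - eps * itg k a t) a b _ d0) => // s t as_ st tb ts.
  have := loc s t as_ st tb ts; rewrite (itg_cat (b := s) (c := t) ki as_ st) ler_norml; lra.
have dn : - P b - eps * itg k a b <= - P a - eps * itg k a a.
  apply: (@local_nonincreasing (fun t => - P t - eps * itg k a t) a b _ d0) => // s t as_ st tb ts.
  have := loc s t as_ st tb ts; rewrite (itg_cat (b := s) (c := t) ki as_ st) ler_norml; lra.
by move: up dn; rewrite itg_point ler_norml; lra.
Qed.
End LocallyIntegrable.

(** * Locally square-integrable functions *)

Section SquareIntegrable.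
Variable R : realType.
Notation mu := (@lebesgue_measure R).
Implicit Types (f g : R -> R) (a b c s t : R).

Lemma L2loc_scalarP f :
  L2loc_scalar f <-> measurable_fun setT f /\ locint (fun t => f t ^+ 2).
Proof.
have mX : measurable_fun setT f -> measurable_fun setT (fun t => f t ^+ 2).
  exact: measurable_funX.
split=> [[mf fi]|[mf [_ fi]]]; split=> //.
  split=> [|a b]; first exact: mX.
  apply/integrableP; split; first by apply/measurable_EFinP; apply: measurable_funTS; exact: mX.
  under eq_integral => t _ do rewrite /= ger0_norm ?sqr_ge0 //.
  exact: fi.
move=> a b; have /integrableP[_] := fi a b.
by under eq_integral => t _ do rewrite /= ger0_norm ?sqr_ge0 //.
Qed.

Lemma L2loc_scalarM f g : L2loc_scalar f -> L2loc_scalar g -> locint (fun t => f t * g t).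
Proof.
move=> /L2loc_scalarP[mf fi] /L2loc_scalarP[mg gi].
apply: (locint_le (g := fun t => f t ^+ 2 + g t ^+ 2)).
- exact: measurable_funM.
- exact: locintD.
move=> t; rewrite normrM -[f t ^+ 2]real_normK ?num_real // -[g t ^+ 2]real_normK ?num_real //.
by have := sqr_ge0 (`|f t| - `|g t|); have := normr_ge0 (f t); have := normr_ge0 (g t); nra.
Qed.

Lemma L2loc_scalarZ c f : L2loc_scalar f -> L2loc_scalar (fun t => c * f t).
Proof.
move=> /L2loc_scalarP[mf fi]; apply/L2loc_scalarP; split.
  by apply: measurable_funM => //; exact: measurable_cst.
by under eq_fun do rewrite exprMn; exact: locintZ.
Qed.

Lemma L2loc_scalarD f g : L2loc_scalar f -> L2loc_scalar g -> L2loc_scalar (fun t => f t + g t).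
Proof.
move=> lf lg; have := L2loc_scalarM lf lg.
move: lf lg => /L2loc_scalarP[mf fi] /L2loc_scalarP[mg gi] fgi; apply/L2loc_scalarP; split.
  exact: measurable_funD.
under eq_fun do rewrite sqrrD -mulr_natl.
by apply: locintD => //; apply: locintD => //; exact: locintZ.
Qed.

Lemma L2loc_scalar_bounded f : measurable_fun setT f ->
  (forall a b, exists M : R, forall t, a <= t <= b -> `|f t| <= M) -> L2loc_scalar f.
Proof.
move=> mf bf; apply/L2loc_scalarP; split=> //; apply: locint_bounded.
  exact: measurable_funX.
move=> a b; have [M fM] := bf a b; exists (M ^+ 2) => t tab.
have h := fM t tab; have h0 := le_trans (normr_ge0 (f t)) h.
by rewrite normrX lerXn2r ?nnegrE.
Qed.

Lemma L2loc_scalar_prim f F : prim f F -> L2loc_scalar F.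
Proof.
move=> fF; apply: L2loc_scalar_bounded; first exact: prim_measurable fF.
by move=> a b; exact: prim_bounded fF.
Qed.

Lemma L2loc_scalar_cst c : L2loc_scalar (fun _ : R => c).
Proof. by apply: L2loc_scalar_bounded => [|a b]; [exact: measurable_cst | exists `|c|]. Qed.

Lemma L2loc_scalar_sum I (s : seq I) (f : I -> R -> R) :
  (forall i, L2loc_scalar (f i)) -> L2loc_scalar (fun t => \sum_(i <- s) f i t).
Proof.
move=> fi; elim: s => [|i s IH].
  by under eq_fun do rewrite big_nil; exact: L2loc_scalar_cst.
under eq_fun do rewrite big_cons; exact: L2loc_scalarD.
Qed.
End SquareIntegrable.

(** * Translation in time *)

Section Shift.
Variable R : realType.
Notation mu := (@lebesgue_measure R).
Variable c : R.
Implicit Types (f g F G : R -> R) (a b s t : R).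

Definition translate (t : R) : R := t + c.

Lemma measurable_translate : measurable_fun setT translate.
Proof. by apply: measurable_funD; [exact: measurable_id | exact: measurable_cst]. Qed.

Lemma preimage_translate a b (b0 b1 : bool) :
  translate @^-1` [set` Interval (BSide b0 (a + c)) (BSide b1 (b + c))] =
  [set` Interval (BSide b0 a) (BSide b1 b)].
Proof.
apply/seteqP; split=> t; rewrite /= !in_itv /= /translate;
  by case: b0 b1 => -[] /=; rewrite ?(lerD2r, ltrD2r).
Qed.

Let mtr : @measurable_fun _ _ (measurableTypeR R) (measurableTypeR R) setT translate.
Proof. exact: measurable_translate. Qed.

Let nu : {measure set (measurableTypeR R) -> \bar R} :=
  measure_function_pushforward__canonical__measure_function_Measure mu mtr.

(** By uniqueness of Lebesgue measure it suffices to compare the two measures on intervals. *)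
Let translate_mu A : measurable A -> mu A = nu A.
Proof.
apply: lebesgue_measure_unique => _ [[a b] _ <-]; rewrite /nu /= /pushforward.
rewrite -{2}[a](subrK c) -{2}[b](subrK c) preimage_translate.
by rewrite !lebesgue_measure_itv /= !lte_fin ltrD2r -!EFinB opprD addrACA subrr addr0.
Qed.

Lemma ge0_itg_translate f a b : measurable_fun setT f -> (forall t, 0 <= f t) ->
  (\int[mu]_(t in `[a, b]) (f (translate t))%:E =
   \int[mu]_(t in `[(a + c)%R, (b + c)%R]) (f t)%:E)%E.
Proof.
move=> mf f0; rewrite -(preimage_translate a b true false).
rewrite -(@ge0_integral_pushforward _ _ _ _ _ _ mtr mu _ (EFin \o f)) //.
- apply: (@eq_measure_integral _ _ _ _ mu) => A mA _; exact/esym/translate_mu.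
- by apply/measurable_EFinP; exact: measurable_funTS.
by move=> t _; rewrite lee_fin.
Qed.

Lemma locint_translate f : locint f -> locint (f \o translate).
Proof.
move=> [mf fi]; split; first exact: measurableT_comp measurable_translate.
move=> a b; apply/integrableP; split.
  apply/measurable_EFinP; apply: measurable_funTS.
  exact: measurableT_comp measurable_translate.
have /integrableP[_] := fi (a + c) (b + c).
by rewrite -(@ge0_itg_translate (fun t => `|f t|)) //; exact: measurableT_comp.
Qed.

Lemma itg_translate f a b : locint f -> itg (f \o translate) a b = itg f (a + c) (b + c).
Proof.
move=> fi; have [mf fi'] := fi; rewrite /itg /Rintegral; congr fine.
rewrite -(preimage_translate a b true false).
rewrite -(@integral_pushforward _ _ _ _ _ _ mtr mu _ (EFin \o f)) //.
- apply: (@eq_measure_integral _ _ _ _ mu) => A mA _; exact/esym/translate_mu.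
- exact/measurable_EFinP.
by rewrite preimage_translate; have [_] := locint_translate fi; apply.
Qed.

Lemma prim_translate f F : prim f F -> prim (f \o translate) (F \o translate).
Proof.
move=> [fi fF]; split; first exact: locint_translate.
by move=> s t st; rewrite itg_translate // -fF // lerD2r.
Qed.

Lemma L2loc_scalar_translate f : L2loc_scalar f -> L2loc_scalar (f \o translate).
Proof.
move=> /L2loc_scalarP[mf fi]; apply/L2loc_scalarP; split.
  exact: measurableT_comp measurable_translate.
exact: locint_translate fi.
Qed.
End Shift.

(** * Concatenation of functions at a time c *)

Section Glue.
Variable R : realType.
Notation mu := (@lebesgue_measure R).
Variable c : R.
Implicit Types (f g F G : R -> R) (a b s t : R).

Definition glue T (f g : R -> T) t := if t <= c then f t else g t.

Lemma measurable_glue f g :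
  measurable_fun setT f -> measurable_fun setT g -> measurable_fun setT (glue f g).
Proof.
move=> mf mg; apply: measurable_fun_ifT => //.
by apply: measurable_fun_ler; [exact: measurable_id | exact: measurable_cst].
Qed.

Lemma locint_glue f g : locint f -> locint g -> locint (glue f g).
Proof.
move=> fi gi; apply: (locint_le (g := fun t => `|f t| + `|g t|)).
- by apply: measurable_glue; [case: fi | case: gi].
- by apply: locintD; exact: locint_norm.
by move=> t; rewrite /glue; case: ifP => _; rewrite ?lerDl ?lerDr.
Qed.

Lemma itg_gluel f g a b : b <= c -> itg (glue f g) a b = itg f a b.
Proof.
by move=> bc; apply: eq_itg => t /andP[_ tb]; rewrite /glue (le_trans tb bc).
Qed.

(** If [a = c], the glued function still takes the value of [f] at [a]; passing to half-open
    intervals discards that point. *)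
Lemma itg_gluer f g a b : locint f -> locint g -> c <= a -> itg (glue f g) a b = itg g a b.
Proof.
move=> fi gi ca; have [_ hi] := locint_glue fi gi; have [_ gi'] := gi.
have sub h : locint h -> mu.-integrable `]a, b] (EFin \o h).
  move=> [_ hi']; apply: integrableS (hi' a b) => //.
  by apply: subset_itvr; rewrite bnd_simp.
have e h : locint h -> itg h a b = Rintegral mu `]a, b] h.
  by move=> hi'; rewrite /itg -Rintegral_itv_obnd_cbnd //; exact: sub.
rewrite !e //; last exact: locint_glue.
apply: eq_Rintegral => t; rewrite inE /= in_itv /= => /andP[at_ _].
by rewrite /glue ifF //; apply/negbTE; rewrite -ltNge (le_lt_trans ca at_).
Qed.

Lemma itg_glue f g a b : locint f -> locint g -> a <= c -> c <= b ->
  itg (glue f g) a b = itg f a c + itg g c b.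
Proof.
move=> fi gi ac cb; rewrite (itg_cat (b := c)) //; last exact: locint_glue.
by rewrite itg_gluel // itg_gluer.
Qed.

Lemma prim_glue f g F G : prim f F -> prim g G -> F c = G c -> prim (glue f g) (glue F G).
Proof.
move=> [fi fF] [gi gG] FG; split; first exact: locint_glue.
move=> s t st; rewrite {1 2}/glue.
have [tc|ct] := leP t c; first by rewrite (le_trans st tc) itg_gluel // fF.
have [sc|cs] := leP s c; last by rewrite itg_gluer ?(ltW cs) // gG.
by rewrite itg_glue ?(ltW ct) // -fF // -gG ?(ltW ct) // FG; ring.
Qed.

Lemma L2loc_scalar_glue f g : L2loc_scalar f -> L2loc_scalar g -> L2loc_scalar (glue f g).
Proof.
move=> /L2loc_scalarP[mf fi] /L2loc_scalarP[mg gi]; apply/L2loc_scalarP; split.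
  exact: measurable_glue.
rewrite (_ : (fun t => _) = glue (fun t => f t ^+ 2) (fun t => g t ^+ 2)).
  exact: locint_glue.
by apply/funext => t; rewrite /glue; case: ifP.
Qed.
End Glue.

(** * Linear differential equations *)

Lemma is_derive_prim (R : realType) (f F : R -> R) :
  continuous f -> (forall t : R, is_derive t (1 : R) F (f t)) -> prim f F.
Proof.
move=> cf dF.
have dF' t : derivable F t 1 by have [] := dF t.
have cF : continuous F.
  by move=> t; apply: differentiable_continuous; apply/derivable1_diffP.
split.
  split=> [|a b]; first exact: continuous_measurable_fun.
  apply: continuous_compact_integrable; first exact: segment_compact.
  exact: continuous_subspaceT.
move=> s t; rewrite le_eqVlt => /predU1P[->|st]; first by rewrite subrr itg_point.
have := @continuous_FTC2 _ f F s t st (continuous_subspaceT cf).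
rewrite /itg /Rintegral => -> //.
- split=> [x _|//|]; first exact: dF'.
  - by apply: cvg_at_right_filter; exact: cF.
  by apply: cvg_at_left_filter; exact: cF.
by move=> x _; rewrite derive1E; have [] := dF x.
Qed.

Section LinearODE.
Variables (R : realType) (k : nat) (M : 'M[R]_k).
Implicit Types (z : 'cV[R]_k) (t : R).

(** Coefficients of coordinate [i] of [exp(t M) z], treated as a scalar power series so that the
    theory of such series applies. *)
Definition exp_term z (i : 'I_k) (j : nat) : R := (M ^+ j *m z) i 0 / j`!%:R.

Lemma mx_pow_bound z j i :
  `|(M ^+ j *m z) i 0| <= (\sum_a \sum_b `|M a b|) ^+ j * \sum_a `|z a 0|.
Proof.
elim: j i => [|j IH] i.
  by rewrite !expr0 mul1mx mul1r (bigD1 i) //= lerDl sumr_ge0.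
rewrite exprS -[M * _]/(M *m _) -mulmxA mxE; apply: (le_trans (ler_norm_sum _ _ _)).
apply: (le_trans (y := \sum_b `|M i b| * ((\sum_a \sum_b `|M a b|) ^+ j * \sum_a `|z a 0|))).
  by apply: ler_sum => b _; rewrite normrM ler_wpM2l.
rewrite -mulr_suml exprS -mulrA ler_wpM2r //.
  by rewrite mulr_ge0 ?exprn_ge0 // !sumr_ge0 // => a _; rewrite sumr_ge0.
rewrite [leRHS](bigD1 i) //= lerDl sumr_ge0 // => a _; exact: sumr_ge0.
Qed.

Lemma is_cvg_exp z i t : cvgn (pseries (exp_term z i) t).
Proof.
apply: normed_cvg.
set N := \sum_a \sum_b `|M a b|; set S := \sum_a `|z a 0|.
have N0 : 0 <= N by rewrite sumr_ge0 // => a _; exact: sumr_ge0.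
have S0 : 0 <= S by exact: sumr_ge0.
apply: (@series_le_cvg _ _ (fun j => S * exp_coeff (N * `|t|) j)) => [j|j|j|].
- exact: normr_ge0.
- by rewrite mulr_ge0 // exp_coeff_ge0 // mulr_ge0.
- rewrite /exp_term /exp_coeff /= !normrM normfV normr_nat normrX exprMn.
  rewrite mulrAC !mulrA ler_wpM2r // ?invr_ge0 // ler_wpM2r ?exprn_ge0 //.
  by rewrite [leRHS]mulrC; exact: mx_pow_bound.
by apply: is_cvg_seriesZ; exact: is_cvg_series_exp_coeff.
Qed.

Definition exp_sol z t : 'cV[R]_k := \col_i limn (pseries (exp_term z i) t).

Lemma cvg_exp_sol z t (a : 'I_k -> R) :
  (\sum_i a i * pseries (exp_term z i) t n) @[n --> \oo] --> \sum_i a i * exp_sol z t i 0.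
Proof.
elim: (index_enum _) => [|i s IH].
  by under eq_fun do rewrite big_nil; rewrite big_nil; exact: cvg_cst.
under eq_fun do rewrite big_cons; rewrite big_cons.
by apply: cvgD IH; apply: cvgMl_tmp; rewrite mxE; exact: is_cvg_exp.
Qed.

Lemma sum_pseries_exp z t p (N : 'M[R]_(p, k)) l n :
  \sum_i N l i * pseries (exp_term z i) t n =
  \sum_(0 <= j < n) (N *m (M ^+ j *m z)) l 0 / j`!%:R * t ^+ j.
Proof.
under eq_bigr do rewrite /pseries /series /= mulr_sumr.
rewrite exchange_big /=; apply: eq_bigr => j _.
rewrite [in RHS]mxE !mulr_suml; apply: eq_bigr => i _.
by rewrite /exp_term; ring.
Qed.

Lemma exp_sol_mul z t : exp_sol (M *m z) t = M *m exp_sol z t.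
Proof.
apply/colP => l; rewrite !mxE; apply/cvg_lim => //.
have := @cvg_exp_sol z t (M l); apply: cvg_trans; apply: near_eq_cvg.
apply: nearW => n; rewrite sum_pseries_exp; apply: eq_bigr => j _.
rewrite /exp_term; congr (_ / _ * _); rewrite !mulmxA.
by have := congr1 (fun Q => (Q *m z) l 0) (commrX j (commr_refl M)).
Qed.

Lemma exp_sol_diff z t i :
  is_derive t (1 : R) (fun t => exp_sol z t i 0) ((M *m exp_sol z t) i 0).
Proof.
(* Differentiating the series termwise amounts to replacing [y] by [M *m y]. *)
have dE y : pseries_diffs (exp_term y i) = exp_term (M *m y) i.
  apply/funext => j; rewrite /pseries_diffs /exp_term exprSr -[_ * M]/(_ *m M) mulmxA.
  rewrite factS natrM invfM.
  by rewrite mulrCA mulVKf // pnatr_eq0.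
rewrite -exp_sol_mul mxE -dE (_ : (fun t => _) = (fun t => limn (pseries (exp_term z i) t))).
  apply: (@pseries_snd_diffs _ _ (`|t| + 1)); rewrite ?dE; try exact: is_cvg_exp.
  by rewrite [ltRHS]ger0_norm ?ltrDl // addr_ge0.
by apply/funext => s; rewrite mxE.
Qed.

Lemma exp_sol0 z : exp_sol z 0 = z.
Proof.
apply/colP => i; rewrite mxE; apply/cvg_lim => //.
rewrite -(cvg_shiftS (pseries _ _)).
rewrite (_ : [sequence _]_n = cst (z i 0)); first exact: cvg_cst.
apply/funext => n; rewrite /pseries /series /= big_nat_recl // big1 ?addr0.
  by rewrite /exp_term expr0 mul1mx fact0 divr1 mulr1.
by move=> j _; rewrite expr0n mulr0.
Qed.

Lemma exp_sol_prim z i : prim (fun t => (M *m exp_sol z t) i 0) (fun t => exp_sol z t i 0).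
Proof.
apply: is_derive_prim => [t|t]; last exact: exp_sol_diff.
have := exp_sol_diff (M *m z) t i; under eq_fun do rewrite exp_sol_mul.
by case=> /derivable1_diffP/differentiable_continuous.
Qed.

Lemma exp_sol_ker z p (N : 'M[R]_(p, k)) t :
  (forall j, N *m (M ^+ j *m z) = 0) -> N *m exp_sol z t = 0.
Proof.
move=> N0; apply/colP => l; rewrite !mxE.
have := @cvg_exp_sol z t (N l).
rewrite (_ : (fun n => _) = cst 0) => [h|]; first by rewrite -(cvg_lim (@Rhausdorff R) h) lim_cst.
apply/funext => n; rewrite sum_pseries_exp big1 // => j _.
by rewrite N0 mxE !mul0r.
Qed.
End LinearODE.

(** * Available storage *)

Section Trajectories.
Variables (R : realType) (d n m : nat).
Variables (A : 'M[R]_d) (B : 'M[R]_(d, n)) (C : 'M[R]_(m, d)) (D : 'M[R]_(m, n)).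
Notation mu := (@lebesgue_measure R).
Implicit Types (u : R -> 'cV[R]_n) (x : R -> 'cV[R]_d) (y : R -> 'cV[R]_m) (a b c s t : R).

Lemma L2locD k (v w : R -> 'cV[R]_k) : L2loc v -> L2loc w -> L2loc (fun t => v t + w t).
Proof.
by move=> lv lw i; under eq_fun do rewrite mxE; exact: L2loc_scalarD (lv i) (lw i).
Qed.

Lemma L2locM k l (N : 'M[R]_(k, l)) (v : R -> 'cV[R]_l) : L2loc v -> L2loc (fun t => N *m v t).
Proof.
move=> lv i; under eq_fun do rewrite mxE.
by apply: L2loc_scalar_sum => j; exact: L2loc_scalarZ (lv j).
Qed.

Lemma locint_dot k (v : R -> 'cV[R]_k) : L2loc v -> locint (fun t => dot (v t) (v t)).
Proof.
move=> lv; under eq_fun do rewrite dotE.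
by apply: locint_sum => i; exact: L2loc_scalarM.
Qed.

(** The output is left out: it equals [C x + D u] almost everywhere, which is all that the integral
    sees. *)
Definition traj u x := L2loc u /\
  forall i, prim (fun t => (A *m x t + B *m u t) i 0) (fun t => x t i 0).

Definition cost u x a b := itg (fun t => supply C D (x t) (u t)) a b.

Lemma traj_L2loc u x : traj u x -> L2loc x.
Proof. by move=> [_ px] i; exact: L2loc_scalar_prim (px i). Qed.

Lemma traj_output_L2loc u x : traj u x -> L2loc (fun t => C *m x t + D *m u t).
Proof. by move=> tx; apply: L2locD; apply: L2locM; [exact: traj_L2loc tx|case: tx]. Qed.

Lemma supply_locint u x : traj u x -> locint (fun t => supply C D (x t) (u t)).
Proof.
move=> tx; under eq_fun do rewrite /supply -[X in _ + X]mulN1r.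
apply: locintD; first by apply: locint_dot; exact: traj_output_L2loc.
by apply: locintZ; apply: locint_dot; case: tx.
Qed.

Lemma in_Bs_traj u y x : in_Bs A B C D u y x -> traj u x.
Proof.
move=> [lu ly lx xe _]; split=> // i.
have /L2loc_scalarP[mf _] : L2loc_scalar (fun t => (A *m x t + B *m u t) i 0).
  by apply: (L2locD (L2locM A lx) (L2locM B lu)).
split=> [|s t st]; last by have [_ ->] := xe s t st i.
split=> // a b; have [ab|ba] := leP a b; first by have [] := xe a b ab i.
by rewrite set_itv_ge ?bnd_simp -?ltNge //; exact: integrable_set0.
Qed.

Lemma traj_in_Bs u x : traj u x -> in_Bs A B C D u (fun t => C *m x t + D *m u t) x.
Proof.
move=> tx; have [lu px] := tx; split=> //.
- exact: traj_output_L2loc.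
- exact: traj_L2loc tx.
- by move=> s t st i; have [[_ fi] fe] := px i; split; [exact: fi | exact: fe].
exact: aeW.
Qed.

Lemma in_Bs_cost u y x a b : in_Bs A B C D u y x ->
  (\int[mu]_(t in `[a, b]) (((y t)^T *m y t) 0 0 - ((u t)^T *m u t) 0 0)%:E =
   (cost u x a b)%:E)%E.
Proof.
move=> Bs; have tx := in_Bs_traj Bs; have [lu ly lx _ ye] := Bs.
have [msup isup] := supply_locint tx.
rewrite /cost /itg /Rintegral fineK; last by apply: integrable_fin_num => //; exact: isup.
have [my _] : locint (fun t => dot (y t) (y t) + (- 1) * dot (u t) (u t)).
  by apply: locintD; [exact: locint_dot | apply: locintZ; exact: locint_dot].
apply: ae_eq_integral => //.
- apply/measurable_EFinP; apply: measurable_funTS.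
  by move: my; under eq_fun do rewrite mulN1r.
- by apply/measurable_EFinP; exact: measurable_funTS.
have [N [mN N0 yN]] := ye; exists N; split=> // t /= h; apply: yN => /= yt; apply: h => _.
by rewrite /supply -yt.
Qed.

Lemma cost_le_avail t0 t1 u x : traj u x -> t0 <= t1 ->
  ((cost u x t0 t1)%:E <= avail_storage A B C D t0 (x t0))%E.
Proof.
move=> tx t01; apply: ereal_sup_ubound => /=.
have Bs := traj_in_Bs tx.
by exists t1, u, (fun t => C *m x t + D *m u t), x; split => //; rewrite (in_Bs_cost _ _ Bs).
Qed.

Lemma avail_le t0 (x0 : 'cV[R]_d) (M : \bar R) :
  (forall t1 u x, t0 <= t1 -> traj u x -> x t0 = x0 -> ((cost u x t0 t1)%:E <= M)%E) ->
  (avail_storage A B C D t0 x0 <= M)%E.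
Proof.
move=> h; apply: ge_ereal_sup => _ [t1 [u [y [x [t01 Bs x0E ->]]]]].
by rewrite (in_Bs_cost _ _ Bs); apply: h => //; exact: in_Bs_traj Bs.
Qed.

(** The chain rule for a quadratic form, by expanding it into products of coordinates and using
    [primM]. *)
Lemma storage_prim X u x : X^T = X -> traj u x ->
  prim (fun t => 2 * dot (x t) (X *m (A *m x t + B *m u t))) (fun t => dot (x t) (X *m x t)).
Proof.
move=> Xs [_ px].
have := @prim_sum R _ (index_enum _) _ _ (fun i => @prim_sum R _ (index_enum _) _ _
  (fun j => primZ (X i j) (primM (px i) (px j)))).
congr prim; apply/funext => t; last first.
  rewrite dotE; apply: eq_bigr => i _; rewrite mxE mulr_sumr; apply: eq_bigr => j _; ring.
have e v w : dot v (X *m w) = \sum_i \sum_j X i j * (v i 0 * w j 0).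
  rewrite dotE; apply: eq_bigr => i _; rewrite mxE mulr_sumr; apply: eq_bigr => j _; ring.
set f := A *m x t + B *m u t.
have -> : 2 * dot (x t) (X *m f) = dot f (X *m x t) + dot (x t) (X *m f).
  by rewrite (dotC f) dot_mull Xs; ring.
rewrite !e -big_split; apply: eq_bigr => i _; rewrite -big_split; apply: eq_bigr => j _ /=; ring.
Qed.

Lemma dissip_cost X u x a b : X^T = X -> dissip A B C D X -> traj u x -> a <= b ->
  cost u x a b <= dot (x a) (X *m x a) - dot (x b) (X *m x b).
Proof.
move=> Xs dX tx ab; have [pi pe] := storage_prim Xs tx; have := pe a b ab.
have si := supply_locint tx.
suff : itg (fun t => 2 * dot (x t) (X *m (A *m x t + B *m u t)) + supply C D (x t) (u t)) a b <= 0.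
  by rewrite itgD // -/(cost u x a b); lra.
rewrite -[leRHS](mul0r (b - a)) -(itg_cst 0 ab); apply: itg_le => [||t _]; last exact: dX.
  exact: locintD.
exact: locint_cst.
Qed.

Lemma avail_le_storage X t0 (x0 : 'cV[R]_d) : psd X -> dissip A B C D X ->
  (avail_storage A B C D t0 x0 <= (dot x0 (X *m x0))%:E)%E.
Proof.
move=> [Xs X0] dX; apply: avail_le => t1 u x t01 tx <-; rewrite lee_fin.
by apply: le_trans (dissip_cost Xs dX tx t01) _; rewrite gerBl X0.
Qed.
End Trajectories.

(** * Quadratic forms from the parallelogram law, after Jordan and von Neumann *)

Section QuadraticForm.
Variables (R : realType) (k : nat) (s : 'cV[R]_k -> R).
Hypothesis s_ge0 : forall x, 0 <= s x.
Hypothesis sZ : forall c x, s (c *: x) = c ^+ 2 * s x.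
Hypothesis s_para : forall x y, s (x + y) + s (x - y) = 2 * s x + 2 * s y.

Let b x y := (s (x + y) - s (x - y)) / 4.

Let sN x : s (- x) = s x.
Proof. by rewrite -scaleN1r sZ sqrrN expr1n mul1r. Qed.

Let bC x y : b x y = b y x.
Proof. by rewrite /b (addrC x y) -(sN (x - y)) opprB. Qed.

Let bDsum x x' y : b (x + x') y + b (x - x') y = 2 * b x y.
Proof.
have := s_para (x + y) x'; have := s_para (x - y) x'; rewrite /b.
rewrite (addrAC x y x') (addrAC x y (- x')) (addrAC x (- y) x') (addrAC x (- y) (- x')).
lra.
Qed.

Let b0 y : b 0 y = 0.
Proof. by rewrite /b add0r sub0r sN subrr mul0r. Qed.

Let bD x y z : b (x + y) z = b x z + b y z.
Proof.
(* Half sum and half difference reduce additivity to [bDsum], applied to [(p, q)] and to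
   [(p, p)]. *)
pose p := 2^-1 *: (x + y); pose q := 2^-1 *: (x - y).
have px : p + q = x by apply/colP => i; rewrite !mxE; field.
have qy : p - q = y by apply/colP => i; rewrite !mxE; field.
have pp : p + p = x + y by apply/colP => i; rewrite !mxE; field.
have := bDsum p q z; rewrite px qy => ->.
by have := bDsum p p z; rewrite subrr b0 addr0 pp => <-.
Qed.

Let bN x y : b (- x) y = - b x y.
Proof. by apply/eqP; rewrite -addr_eq0 -bD addNr b0. Qed.

Let bMn x y i : b (x *+ i) y = b x y *+ i.
Proof. by elim: i => [|i IH]; rewrite ?mulr0n ?b0 // !mulrS bD IH. Qed.

Let bMz x y (i : int) : b (x *~ i) y = b x y *~ i.
Proof. by case: i => i; rewrite -?pmulrn ?bMn // NegzE !mulrNz bN -!pmulrn bMn. Qed.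

(** Plays the part of continuity in the passage from integer to real scalars. *)
Let b_bound c x y : 0 <= c <= 1 -> `|b (c *: x) y| <= s x + s y.
Proof.
move=> /andP[c0 c1]; have := s_para (c *: x) y; rewrite sZ => h.
have c2 : c ^+ 2 * s x <= s x by apply: ler_piMl => //; rewrite expr_le1.
have := s_ge0 (c *: x + y); have := s_ge0 (c *: x - y); rewrite ler_norml /b; lra.
Qed.

(* [n b(cx, y) = b(frac(nc) x, y) + floor(nc) b(x, y)], with the first term bounded. *)
Let bZ c x y : b (c *: x) y = c * b x y.
Proof.
apply/eqP; rewrite -subr_eq0; apply/eqP; set e := b (c *: x) y - _.
pose K := s x + s y + `|b x y|.
have K0 : 0 <= K by rewrite !addr_ge0.
apply: (@small_eq0 _ _ K) => // eps eps0.
pose N := (Num.bound eps^-1).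
have N0 : 0 < N%:R :> R.
  by apply: le_lt_trans (archi_boundP _); rewrite ?invr_ge0 ltW // invr_gt0.
have Neps : 1 <= eps * N%:R.
  rewrite -(ler_pdivrMl _ _ eps0) mulr1; apply: ltW; apply: archi_boundP.
  by rewrite invr_ge0 ltW.
suff h : `|e| * N%:R <= K.
  rewrite -(ler_pM2r N0); apply: (le_trans h).
  by rewrite -mulrA (mulrC K) mulrA ler_peMl.
pose f := Num.floor (N%:R * c).
pose fr := N%:R * c - f%:~R.
have /andP[fr0 fr1] : 0 <= fr <= 1.
  have /andP[h1 h2] := floor_itv (N%:R * c).
  by move: h2; rewrite intrD /fr subr_ge0 h1 /= -/f; lra.
have NE : b (c *: x) y * N%:R = b (fr *: x) y + f%:~R * b x y.
  rewrite mulr_natr -bMn -scaler_nat scalerA.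
  have -> : N%:R * c = fr + f%:~R by rewrite /fr subrK.
  by rewrite scalerDl bD scaler_int bMz mulrzl.
have -> : `|e| * N%:R = `|b (fr *: x) y - fr * b x y|.
  rewrite -{1}(ger0_norm (ltW N0)) -normrM /e mulrBl NE; congr (`| _ |).
  by rewrite /fr; ring.
apply: le_trans (ler_normB _ _) _; rewrite /K lerD ?b_bound ?fr0 //.
by rewrite normrM ger0_norm // ler_piMl.
Qed.

Lemma quadratic_form : exists X : 'M[R]_k, X^T = X /\ forall x, s x = dot x (X *m x).
Proof.
pose X := \matrix_(i, j) b (delta_mx i 0) (delta_mx j 0); exists X; split.
  by apply/matrixP => i j; rewrite !mxE bC.
have bsum (a : 'cV_k) y : b a y = \sum_i a i 0 * b (delta_mx i 0) y.
  have {1}-> : a = \sum_i a i 0 *: delta_mx i 0.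
    by rewrite {1}[a]matrix_sum_delta; apply: eq_bigr => i _; rewrite big_ord1.
  by elim/big_rec2: _ => [|i p q _ <-]; rewrite ?b0 // bD bZ.
move=> x; have -> : s x = b x x.
  have := s_para x x; rewrite /b subrr; have := sZ 0 x; rewrite scale0r expr0n mul0r => ->.
  lra.
rewrite bsum dotE; apply: eq_bigr => i _; congr (_ * _).
by rewrite bC bsum mxE; apply: eq_bigr => j _; rewrite !mxE bC mulrC.
Qed.
End QuadraticForm.

(** * The available storage as a function of the initial state *)

Section AvailableStorage.
Variables (R : realType) (d n m : nat).
Variables (A : 'M[R]_d) (B : 'M[R]_(d, n)) (C : 'M[R]_(m, d)) (D : 'M[R]_(m, n)).
Notation mu := (@lebesgue_measure R).
Notation traj := (traj A B).
Notation cost := (cost C D).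
Implicit Types (u v : R -> 'cV[R]_n) (x z : R -> 'cV[R]_d) (a b c s t : R).

Lemma trajD u v x z : traj u x -> traj v z ->
  traj (fun t => u t + v t) (fun t => x t + z t).
Proof.
move=> [lu px] [lv pz]; split; first exact: L2locD.
move=> i; have := primD (px i) (pz i); congr prim; apply/funext => t; last by rewrite !mxE.
by rewrite !mulmxDr addrACA [in RHS]mxE.
Qed.

Lemma trajZ c u x : traj u x -> traj (fun t => c *: u t) (fun t => c *: x t).
Proof.
move=> [lu px]; split.
  by move=> i; under eq_fun do rewrite mxE; exact: L2loc_scalarZ (lu i).
move=> i; have := primZ c (px i); congr prim; apply/funext => t; last by rewrite !mxE.
by rewrite -!scalemxAr -scalerDr [in RHS]mxE.
Qed.

Lemma traj_glue c u v x z : traj u x -> traj v z -> x c = z c ->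
  traj (glue c u v) (glue c x z).
Proof.
move=> [lu px] [lv pz] xz; split=> i.
  have := L2loc_scalar_glue c (lu i) (lv i); congr L2loc_scalar.
  by apply/funext => t; rewrite /glue; case: ifP.
have := prim_glue (px i) (pz i) (congr1 (fun w : 'cV_d => w i 0) xz).
by congr prim; apply/funext => t; rewrite /glue; case: ifP.
Qed.

Lemma traj_translate c u x : traj u x -> traj (u \o translate c) (x \o translate c).
Proof.
move=> [lu px]; split=> i; first exact: L2loc_scalar_translate (lu i).
exact: prim_translate (px i).
Qed.

Lemma cost_glue a b c u v x z : traj u x -> traj v z -> x c = z c -> a <= c -> c <= b ->
  cost (glue c u v) (glue c x z) a b = cost u x a c + cost v z c b.
Proof.
move=> tx tz xz ac cb.
apply: etrans (itg_glue (supply_locint C D tx) (supply_locint C D tz) ac cb).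
by apply: eq_itg => t _; rewrite /glue; case: ifP.
Qed.

Lemma cost_translate a b c u x : traj u x ->
  cost (u \o translate c) (x \o translate c) a b = cost u x (a + c) (b + c).
Proof. by move=> tx; exact: (itg_translate c a b (supply_locint C D tx)). Qed.

(** The constant input is adjoined to the state as a component with zero derivative, so a matrix
    exponential solves the augmented system. *)
Lemma traj_const t0 (x0 : 'cV[R]_d) (u0 : 'cV[R]_n) :
  exists2 x, traj (fun _ => u0) x & x t0 = x0.
Proof.
pose M := block_mx A B 0 0 : 'M[R]_(d + n).
pose w := exp_sol M (col_mx x0 u0); pose x t := usubmx (w t); pose v t := dsubmx (w t).
have wE t : M *m w t = col_mx (A *m x t + B *m v t) 0.
  by rewrite -{1}[w t]vsubmxK mul_block_col !mul0mx addr0.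
have pw i := exp_sol_prim M (col_mx x0 u0) i.
have px i : prim (fun t => (A *m x t + B *m v t) i 0) (fun t => x t i 0).
  have := pw (lshift n i); congr prim; apply/funext => t; last by rewrite [RHS]mxE.
  by rewrite -/w wE col_mxEu.
have w0 : w 0 = col_mx x0 u0 by rewrite /w exp_sol0.
have vE t : v t = u0.
  have v0 : v 0 = u0 by rewrite /v w0 col_mxKd.
  have pv i : prim (fun _ => 0) (fun t => v t i 0).
    have := pw (rshift d i); congr prim; apply/funext => s; last by rewrite [RHS]mxE.
    by rewrite -/w wE col_mxEd mxE.
  apply/colP => i; rewrite -v0; have [_ pe] := pv i.
  have [t0'|t0'] := leP 0 t; apply/eqP.
    by rewrite -subr_eq0 pe // itg_cst // mul0r.
  by rewrite eq_sym -subr_eq0 pe ?itg_cst ?mul0r // ltW.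
exists (x \o translate (- t0)); last by rewrite /= /translate subrr /x w0 col_mxKu.
apply: (@traj_translate (- t0) (fun _ => u0) x); split.
  by move=> i; exact: L2loc_scalar_cst.
by move=> i; have := px i; congr prim; apply/funext => t; rewrite vE.
Qed.

(** Cayley-Hamilton: reduce ['X^j] modulo the characteristic polynomial. Dimension 0 is split off
    because polynomials in a matrix need size at least 1. *)
Lemma unobservable_pow (z : 'cV[R]_d) : (forall k : 'I_d, C *m (A ^+ k) *m z = 0) ->
  forall j, C *m (A ^+ j *m z) = 0.
Proof.
case: d A B C z => [|e] A' B' C' z Cz j; first by rewrite (flatmx0 z) !mulmx0.
have -> : A' ^+ j *m z = horner_mx A' ('X^j %% char_poly A') *m z.
  rewrite -{1}(horner_mx_X A') -rmorphXn /= {1}(divp_eq 'X^j (char_poly A')).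
  by rewrite rmorphD rmorphM /= Cayley_Hamilton mulr0 add0r.
set p := _ %% _.
have sp : (size p <= e.+1)%N.
  have := ltn_modp 'X^j (char_poly A'); rewrite monic_neq0 ?char_poly_monic //.
  by rewrite size_char_poly ltnS => ->.
have -> : p = \sum_(i < e.+1) p`_i *: 'X^i.
  rewrite -poly_def; apply/polyP => i; rewrite coef_poly; case: ltnP => // ei.
  by rewrite nth_default // (leq_trans sp).
rewrite raddf_sum mulmx_suml mulmx_sumr big1 // => i _ /=.
rewrite linearZ /= rmorphXn /= horner_mx_X -scalemxAl -scalemxAr mulmxA.
by rewrite Cz scaler0.
Qed.

Lemma traj_unobservable t0 (z : 'cV[R]_d) : (forall k : 'I_d, C *m (A ^+ k) *m z = 0) ->
  exists x, [/\ traj (fun _ => 0) x, x t0 = z & forall t, C *m x t = 0].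
Proof.
move=> Cz; exists (exp_sol A z \o translate (- t0)); split.
- apply: (@traj_translate (- t0) (fun _ => 0)); split.
    by move=> i; under eq_fun do rewrite mxE; exact: L2loc_scalar_cst.
  by move=> i; have := exp_sol_prim A z i; congr prim; apply/funext => t; rewrite mulmx0 addr0.
- by rewrite /= /translate subrr exp_sol0.
by move=> t; apply: exp_sol_ker; exact: unobservable_pow.
Qed.

Lemma supplyZ c (x0 : 'cV[R]_d) (u0 : 'cV[R]_n) : supply C D (c *: x0) (c *: u0) = c ^+ 2 * supply C D x0 u0.
Proof. by rewrite /supply -!scalemxAr -scalerDr !dotB; ring. Qed.

Lemma supply_parallelogram (x0 z0 : 'cV[R]_d) (u0 v0 : 'cV[R]_n) :
  supply C D (x0 + z0) (u0 + v0) + supply C D (x0 + (- 1) *: z0) (u0 + (- 1) *: v0) =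
  2 * supply C D x0 u0 + 2 * supply C D z0 v0.
Proof.
rewrite /supply; set p := C *m x0 + D *m u0; set q := C *m z0 + D *m v0.
have -> : C *m (x0 + z0) + D *m (u0 + v0) = p + q by rewrite !mulmxDr addrACA.
have -> : C *m (x0 + (- 1) *: z0) + D *m (u0 + (- 1) *: v0) = p - q.
  by rewrite !mulmxDr -!scalemxAr !scaleN1r addrACA opprD.
rewrite !scaleN1r !dotB; ring.
Qed.

Variable t0 : R.
Hypothesis avail_fin : forall x0 : 'cV[R]_d, (avail_storage A B C D t0 x0 < +oo)%E.

Definition astore (x0 : 'cV[R]_d) : R := fine (avail_storage A B C D t0 x0).

Lemma avail_ge0 (x0 : 'cV[R]_d) : (0 <= avail_storage A B C D t0 x0)%E.
Proof.
have [x tx <-] := traj_const t0 x0 0.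
by have := cost_le_avail C D tx (lexx t0); rewrite [X in (X%:E <= _)%E]itg_point.
Qed.

Lemma astoreE (x0 : 'cV[R]_d) : avail_storage A B C D t0 x0 = (astore x0)%:E.
Proof. by rewrite /astore fineK // ge0_fin_numE ?avail_ge0. Qed.

Lemma astore_ge0 (x0 : 'cV[R]_d) : 0 <= astore x0.
Proof. by rewrite -lee_fin -astoreE avail_ge0. Qed.

Lemma cost_le_astore t1 u x : traj u x -> t0 <= t1 -> cost u x t0 t1 <= astore (x t0).
Proof. by move=> tx t01; rewrite -lee_fin -astoreE; exact: cost_le_avail. Qed.

Lemma astore_approx (x0 : 'cV[R]_d) eps : 0 < eps -> exists t1 u x,
  [/\ t0 <= t1, traj u x, x t0 = x0 & astore x0 - eps <= cost u x t0 t1].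
Proof.
move=> e0; apply: contrapT => h.
have : (avail_storage A B C D t0 x0 <= (astore x0 - eps)%:E)%E.
  apply: avail_le => t1 u x t01 tx xE; rewrite lee_fin leNgt; apply/negP => c0.
  by apply: h; exists t1, u, x; split=> //; exact: ltW.
by rewrite astoreE lee_fin; lra.
Qed.

(** With zero input the supply is [|C x|^2 >= 0], so prolonging costs nothing; two trajectories can
    thus be compared on a common horizon. *)
Lemma traj_extend u x t1 T : traj u x -> t0 <= t1 -> t1 <= T -> exists v z,
  [/\ traj v z, z t0 = x t0 & cost u x t0 t1 <= cost v z t0 T].
Proof.
move=> tx t01 t1T; have [z tz zE] := traj_const t1 (x t1) 0.
exists (glue t1 u (fun _ => 0)), (glue t1 x z); split; first exact: traj_glue.
  by rewrite /glue t01.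
rewrite cost_glue // lerDl; apply: itg_ge0 => t.
by rewrite /supply mulmx0 addr0 dot0r subr0 dot_ge0.
Qed.

Lemma astore_sup (x0 : 'cV[R]_d) (M : R) :
  (forall t1 u x, t0 <= t1 -> traj u x -> x t0 = x0 -> cost u x t0 t1 <= M) -> astore x0 <= M.
Proof.
by move=> h; rewrite -lee_fin -astoreE; apply: avail_le => *; rewrite lee_fin; exact: h.
Qed.

Lemma astoreZ c (x0 : 'cV[R]_d) : astore (c *: x0) = c ^+ 2 * astore x0.
Proof.
have le1 e y : e ^+ 2 * astore y <= astore (e *: y).
  have [->|e0] := eqVneq e 0; first by rewrite expr0n mul0r astore_ge0.
  have e2 : 0 < e ^+ 2 by rewrite exprn_even_gt0.
  rewrite mulrC -ler_pdivlMr //; apply: astore_sup => t1 u x t01 tx <-.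
  rewrite ler_pdivlMr //; have := cost_le_astore (trajZ e tx) t01.
  rewrite mulrC; apply: le_trans; rewrite le_eqVlt; apply/orP; left; apply/eqP.
  rewrite -[LHS]itgZ; last exact: supply_locint tx.
  by apply: eq_itg => t _; rewrite supplyZ.
apply/eqP; rewrite eq_le le1 andbT.
have [->|c0] := eqVneq c 0.
  (* At the zero state, [le1] with factor 2 gives [4 S(0) <= S(0)]. *)
  by rewrite scale0r expr0n mul0r; have := le1 2 0; rewrite scaler0; have := astore_ge0 0; lra.
have c2 : 0 < c ^+ 2 by rewrite exprn_even_gt0.
have := le1 c^-1 (c *: x0); rewrite scalerA mulVf // scale1r exprVn.
by rewrite mulrC ler_pdivrMr // mulrC.
Qed.

(** Sums and differences of nearly optimal trajectories give one inequality; the same inequality at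
    [x0 + z0] and [x0 - z0], with homogeneity, gives the other. *)
Lemma astore_parallelogram (x0 z0 : 'cV[R]_d) :
  astore (x0 + z0) + astore (x0 - z0) = 2 * astore x0 + 2 * astore z0.
Proof.
have ge y w : 2 * astore y + 2 * astore w <= astore (y + w) + astore (y - w).
  apply/ler_addgt0Pr => eps e0.
  have e4 : 0 < eps / 4 by lra.
  have [t1 [u [x [t01 tx xE cx]]]] := astore_approx y e4.
  have [t2 [v [z [t02 tz zE cz]]]] := astore_approx w e4.
  pose T := Num.max t1 t2.
  have t1T : t1 <= T by rewrite le_max lexx.
  have t2T : t2 <= T by rewrite le_max lexx orbT.
  have t0T : t0 <= T := le_trans t01 t1T.
  have [u' [x' [tx' x'E cx']]] := traj_extend tx t01 t1T.
  have [v' [z' [tz' z'E cz']]] := traj_extend tz t02 t2T.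
  have tN := trajZ (- 1) tz'.
  have h1 := cost_le_astore (trajD tx' tz') t0T.
  have h2 := cost_le_astore (trajD tx' tN) t0T.
  have : cost (fun t => u' t + v' t) (fun t => x' t + z' t) t0 T +
         cost (fun t => u' t + (- 1) *: v' t) (fun t => x' t + (- 1) *: z' t) t0 T =
      2 * cost u' x' t0 T + 2 * cost v' z' t0 T.
    have i1 := supply_locint C D tx'; have i2 := supply_locint C D tz'.
    rewrite -[LHS]itgD; [|exact: supply_locint (trajD tx' tz')|exact: supply_locint (trajD tx' tN)].
    rewrite -[2 * cost u' x' t0 T]itgZ // -[2 * cost v' z' t0 T]itgZ // -itgD; try exact: locintZ.
    by apply: eq_itg => t _; exact: supply_parallelogram.
  by rewrite x'E z'E xE zE scaleN1r in h1 h2; lra.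
apply/eqP; rewrite eq_le ge andbT.
have := ge (x0 + z0) (x0 - z0).
have -> : x0 + z0 + (x0 - z0) = 2 *: x0 by apply/colP => i; rewrite !mxE; ring.
have -> : x0 + z0 - (x0 - z0) = 2 *: z0 by apply/colP => i; rewrite !mxE; ring.
by rewrite !astoreZ; lra.
Qed.

(** Dynamic programming: follow [x] until [t1], then a nearly optimal trajectory from [x t1],
    shifted in time to start at [t1]. *)
Lemma astore_dissip u x t1 : traj u x -> t0 <= t1 ->
  cost u x t0 t1 + astore (x t1) <= astore (x t0).
Proof.
move=> tx t01; apply/ler_addgt0Pr => eps e0.
have [t2 [v [z [t02 tz zE cz]]]] := astore_approx (x t1) e0.
pose c := t0 - t1.
have tz' := traj_translate c tz.
have zc : x t1 = (z \o translate c) t1 by rewrite /= /translate /c addrC subrK zE.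
have tT : t1 <= t2 - c by rewrite /c; lra.
have := cost_le_astore (traj_glue tx tz' zc) (le_trans t01 tT).
rewrite cost_glue // cost_translate // subrK.
have -> : t1 + c = t0 by rewrite /c addrC subrK.
by rewrite {1}/glue t01; lra.
Qed.

(** Subtracting the free motion from [z], whose output is zero, leaves input and output unchanged
    and starts at 0, where the storage vanishes. *)
Lemma astore_unobservable (z : 'cV[R]_d) :
  (forall k : 'I_d, C *m (A ^+ k) *m z = 0) -> astore z <= 0.
Proof.
move=> /(traj_unobservable t0)[x' [tx' x'E Cx']].
apply: astore_sup => t1 u x t01 tx xE.
have tN := trajZ (- 1) tx'.
have := cost_le_astore (trajD tx tN) t01.
have -> : x t0 + (- 1) *: x' t0 = 0 by rewrite xE x'E scaleN1r subrr.
have -> : astore 0 = 0 by rewrite -(scale0r 0) astoreZ expr0n mul0r.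
apply: le_trans; rewrite le_eqVlt; apply/orP; left; apply/eqP; apply: eq_itg => t _.
by rewrite /supply scaler0 addr0 mulmxDr -scalemxAr Cx' scaler0 addr0.
Qed.
End AvailableStorage.

(** * Absolutely continuous vector functions *)

Section VectorPrimitive.
Variable R : realType.

Definition vprim k (v : R -> 'cV[R]_k) := forall i, exists f, prim f (fun t => v t i 0).

Lemma vprim_cst k (c : 'cV[R]_k) : vprim (fun _ => c).
Proof.
move=> i; exists (fun _ => 0); split; first exact: locint_cst.
by move=> s t st; rewrite subrr itg_cst // mul0r.
Qed.

Lemma vprimD k (v w : R -> 'cV[R]_k) : vprim v -> vprim w -> vprim (fun t => v t + w t).
Proof.
move=> pv pw i; have [f pf] := pv i; have [g pg] := pw i.
by exists (fun t => f t + g t); under [X in prim _ X]eq_fun do rewrite mxE; exact: primD.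
Qed.

Lemma prim_lincomb k (v : R -> 'cV[R]_k) (a : 'I_k -> R) : vprim v ->
  exists f, prim f (fun t => \sum_i a i * v t i 0).
Proof.
move=> /choice[f pf]; exists (fun t => \sum_i a i * f i t).
by apply: (@prim_sum R _ _ (fun i t => a i * f i t) (fun i t => a i * v t i 0)) => i; exact: primZ.
Qed.

Lemma vprimM k l (N : 'M[R]_(k, l)) (v : R -> 'cV[R]_l) : vprim v -> vprim (fun t => N *m v t).
Proof.
move=> pv i; have [f pf] := prim_lincomb (N i) pv; exists f.
by under [X in prim _ X]eq_fun do rewrite mxE.
Qed.

Lemma prim_dot k (v w : R -> 'cV[R]_k) : vprim v -> vprim w ->
  exists h, prim h (fun t => dot (v t) (w t)).
Proof.
move=> /choice[f pf] /choice[g pg].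
exists (fun t => \sum_i (f i t * w t i 0 + v t i 0 * g i t)).
under [X in prim _ X]eq_fun do rewrite dotE.
apply: (@prim_sum R _ _ (fun i t => f i t * w t i 0 + v t i 0 * g i t)
  (fun i t => v t i 0 * w t i 0)) => i.
exact: primM.
Qed.
End VectorPrimitive.

(** * Both implications and the value of the storage *)

Section Main.
Variables (R : realType) (d n m : nat).
Variables (A : 'M[R]_d) (B : 'M[R]_(d, n)) (C : 'M[R]_(m, d)) (D : 'M[R]_(m, n)).
Variable t0 : R.

(* If the dissipation inequality failed at [(x0, u0)], the constant input [u0] would violate
   it on a short time interval. *)
Lemma astore_dissip_mx X :
  (forall x0, (avail_storage A B C D t0 x0 < +oo)%E) ->
  X^T = X -> (forall x, astore A B C D t0 x = dot x (X *m x)) -> dissip A B C D X.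
Proof.
move=> fin Xs XE x0 u0; rewrite leNgt; apply/negP => q0.
have [x tx xE] := traj_const A B t0 x0 u0.
pose f t := 2 * dot (x t) (X *m (A *m x t + B *m u0)).
pose g t := f t + supply C D (x t) u0.
have vx : vprim x by move=> i; have [_ px] := tx; eexists; exact: px.
have vu : vprim (fun _ : R => u0) by exact: vprim_cst.
have [h1 p1] := prim_dot vx (vprimM X (vprimD (vprimM A vx) (vprimM B vu))).
have vy := vprimD (vprimM C vx) (vprimM D vu).
have [h2 p2] := prim_dot vy vy.
have [h3 p3] := prim_dot vu vu.
have pg := primD (primZ 2 p1) (primD p2 (primZ (- 1) p3)).
have gE : g = fun t => 2 * dot (x t) (X *m (A *m x t + B *m u0)) +
    (dot (C *m x t + D *m u0) (C *m x t + D *m u0) + (- 1) * dot u0 u0).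
  by apply/funext => t; rewrite /g /f /supply mulN1r.
rewrite -gE in pg.
have g0 : 0 < g t0 by rewrite /g /f xE.
have g2 : 0 < g t0 / 2 by rewrite divr_gt0.
(* Within [del] of [t0] the rate [g] stays above half its initial value, so its integral is
   positive. *)
have [del del0 dP] := prim_modulus t0 (t0 + 1) pg g2.
pose t1 := t0 + Num.min del 1.
have m0 : 0 < Num.min del 1 by rewrite lt_min del0 ltr01.
have t01 : t0 <= t1 by rewrite /t1 lerDl ltW.
have [fi fe] := storage_prim Xs tx.
have si := supply_locint C D tx.
have := astore_dissip fin tx t01; rewrite !XE => h.
have := fe t0 t1 t01; rewrite -/f => e.
have ige : itg g t0 t1 <= 0.
  rewrite /g itgD //; move: h; rewrite -[cost _ _ _ _ _ _]/(itg _ t0 t1); lra.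
have : itg (fun _ => g t0 / 2) t0 t1 <= itg g t0 t1.
  apply: itg_le; [exact: locint_cst|exact: locintD|move=> t /andP[tt0 tt1]].
  have tm : t - t0 <= Num.min del 1 by rewrite lerBlDl.
  have := dP t0 t (lexx _) tt0 _ _; rewrite ler_norml.
  move: tm; rewrite le_min => /andP[td tl]; rewrite lerBlDl in tl.
  by move=> /(_ tl td); lra.
rewrite itg_cst // /t1 addrAC subrr add0r => h'.
by have := mulr_gt0 g2 m0; lra.
Qed.

Lemma finite_avail_storage :
  (forall x0, (avail_storage A B C D t0 x0 < +oo)%E) ->
  exists X : 'M[R]_d, [/\ psd X, dissip A B C D X,
    (forall z : 'cV_d, (forall k : 'I_d, C *m (A ^+ k) *m z = 0) -> X *m z = 0) &
    forall x0, avail_storage A B C D t0 x0 = (dot x0 (X *m x0))%:E].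
Proof.
move=> fin.
have [X [Xs XE]] := quadratic_form (astore_ge0 fin) (astoreZ fin) (astore_parallelogram fin).
have pX : psd X by split=> // x; rewrite -XE astore_ge0.
exists X; split=> //.
- exact: astore_dissip_mx.
- by move=> z zk; apply: psd_ker => //; rewrite -XE; exact: astore_unobservable.
by move=> x0; rewrite -XE astoreE.
Qed.

(** [X] bounds the storage from above, so the storage is finite and has a matrix [Y <= X]; [gap_eq0]
    gives equality. *)
Lemma cond2_avail X : cond2 A B C D X ->
  forall x0, avail_storage A B C D t0 x0 = (dot x0 (X *m x0))%:E.
Proof.
move=> [Xs X0 kX [r [L [W [E1 E2 E3 sX]]]]].
have pX : psd X by split=> // x; rewrite /dot mulmxA.
have lX : lure A B C D X L W by [].
have dX : dissip A B C D X.
  by move=> x u; rewrite (lure_dissip Xs lX) oppr_le0 dot_ge0.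
have ub x0 := avail_le_storage t0 x0 pX dX.
have [|Y [pY dY _ YE]] := finite_avail_storage.
  by move=> x0; exact: le_lt_trans (ub x0) (ltry _).
have YX x0 : dot x0 (Y *m x0) <= dot x0 (X *m x0) by rewrite -lee_fin -YE.
have /eqP := gap_eq0 pX lX sX kX pY dY YX.
by rewrite subr_eq0 => /eqP ->.
Qed.

(** Minimality of [X] comes from [avail_le_storage]: every nonnegative dissipative [Y] bounds the
    storage, whose form is that of [X]. *)
Lemma finite_avail_cond2 :
  (forall x0, (avail_storage A B C D t0 x0 < +oo)%E) -> exists X, cond2 A B C D X.
Proof.
move=> /finite_avail_storage[X [pX dX kX XE]]; have [Xs X0] := pX.
have [r [L [W [fX lX]]]] := dissip_lure Xs dX; exists X.
split=> // [z|]; first by rewrite -mulmxA; exact: X0.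
have [E1 E2 E3] := lX; exists r, L, W; split=> //.
apply: (minimal_spectral_factor pX lX fX) => Y pY dY x.
by rewrite -lee_fin -XE; exact: avail_le_storage.
Qed.
End Main.

Unset Implicit Arguments.
Set Strict Implicit.
Local Close Scope classical_set_scope.

Theorem theorem23 (R : realType) (d n m : nat) (A : 'M[R]_d) (B : 'M[R]_(d, n))
    (C : 'M[R]_(m, d)) (D : 'M[R]_(m, n)) (t0 : R) :
  ((forall x0 : 'cV[R]_d, (avail_storage A B C D t0 x0 < +oo)%E) <->
     (exists X : 'M[R]_d, cond2 A B C D X)) /\
  (forall X : 'M[R]_d, cond2 A B C D X ->
     forall x0 : 'cV[R]_d,
       avail_storage A B C D t0 x0 = (((x0^T *m X *m x0) 0 0)%:E)%E).
Proof.
split; last by move=> X cX x0; rewrite (cond2_avail t0 cX) /dot mulmxA.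
split; first exact: finite_avail_cond2.
by move=> [X cX] x0; rewrite (cond2_avail t0 cX) ltry.
Qed.
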